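(* Suppose that either $X$ and $Y$ are Hilbert spaces, or $X$ is an arbitrary metric space and $Y=\mathbb{R}^n$ for some $n$. Let $A$ be a compact subset of $X$ and $B$ be a compact subset of $Y$ such that $\dim_H A > \overline{\dim}_B B$. Then $B$ can be covered by a Lipschitz image of $A$, that is, there is a Lipschitz map $f\colon A\to Y$ with $B\subset f(A)$.
   Context: $\dim_H$ denotes Hausdorff dimension. For a compact metric space $X$ and $r>0$ let $N(X,r)$ be the minimal number of closed balls of radius $r$ (centered in $X$) that cover $X$; the upper box dimension is $\overline{\dim}_B X=\limsup_{r\to 0+}\frac{\log N(X,r)}{\log(1/r)}\in[0,\infty]$ for nonempty $X$ (the dimensions of the empty set are taken to be $0$). A map $f$ between metric spaces is Lipschitz if there is a finite $C$ with $d(f(x),f(z))\le C\,d(x,z)$ for all $x,z$ in its domain. *)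

(* Defs.v *)
From HB Require Import structures.
From mathcomp Require Import all_boot all_order all_algebra.
From mathcomp Require Import all_classical all_reals all_analysis.
From mathcomp Require Import ring lra.

Set Implicit Arguments.
Unset Strict Implicit.
Unset Printing Implicit Defensive.

Import Order.TTheory GRing.Theory Num.Theory.
Import numFieldNormedType.Exports.

Local Open Scope classical_set_scope.
Local Open Scope ring_scope.

(* Hilbert spaces are real: a complex Hilbert space is one as well, with the
   same metric, under restriction of scalars and the real part of its inner
   product. There is no separability or dimension assumption. [mdist] and the norm
   have the same balls, hence agree: see [hilbert_mdistE]. *)
HB.mixin Record NormedModule_hasInner (R : realType) V
    & NormedModule R V := {
  inner : {dot V for (@idfun R)} ;
  inner_norm : forall x : V, `|x| ^+ 2 = inner x x }.

#[short(type="hilbertType")]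
HB.structure Definition Hilbert (R : realType) :=
  {V of CompleteNormedModule R V & Metric R V & NormedModule_hasInner R V}.

Lemma hilbert_mdistE (R : realType) (V : hilbertType R) (x y : V) :
  mdist x y = `|x - y|.
Proof.
have E d : (mdist x y < d) = (`|x - y| < d).
  have H : ball x d y = ball_ (fun z : V => `|z|) x d y by rewrite -ball_normE.
  by apply/idP/idP; rewrite ballEmdist /ball_ /= in H; rewrite ?H // -H.
apply/eqP; rewrite eq_le; apply/andP; split; rewrite leNgt; apply/negP.
  by rewrite -E ltxx.
by rewrite E ltxx.
Qed.

(* The library metrizes ['rV[R]_n] by the sup norm; this alias carries the
   Euclidean distance instead. *)
Definition euclidean (R : realType) (n : nat) : Type := 'rV[R]_n.

Section EuclideanDistance.
Context (R : realType) (n : nat).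
Implicit Types x y z : 'rV[R]_n.

Definition euclidean_dist x y : R :=
  Num.sqrt (\sum_(i < n) (x ord0 i - y ord0 i) ^+ 2).

Lemma euclidean_dist_xx x : euclidean_dist x x = 0.
Proof.
rewrite /euclidean_dist big1 ?sqrtr0// => i _.
by rewrite subrr expr0n.
Qed.

Lemma euclidean_dist_eq0 x y : euclidean_dist x y = 0 -> x = y.
Proof.
move=> /eqP; rewrite sqrtr_eq0 => le0; apply/rowP => i; apply/eqP.
rewrite -subr_eq0 -sqrf_eq0.
have h0 (j : 'I_n) : true -> 0 <= (x ord0 j - y ord0 j) ^+ 2.
  by move=> _; exact: sqr_ge0.
have /eqP : \sum_(j < n) (x ord0 j - y ord0 j) ^+ 2 == 0.
  by rewrite eq_le le0 sumr_ge0.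
by move=> /(psumr_eq0P h0)/(_ i isT) ->.
Qed.

Lemma euclidean_dist_sym x y : euclidean_dist x y = euclidean_dist y x.
Proof.
by rewrite /euclidean_dist; under eq_bigr do rewrite -sqrrN opprB.
Qed.

Lemma sum_cauchy_schwarz (a b : 'I_n -> R) :
  \sum_(i < n) a i * b i <=
    Num.sqrt (\sum_(i < n) a i ^+ 2) * Num.sqrt (\sum_(i < n) b i ^+ 2).
Proof.
set p := \sum_(i < n) a i ^+ 2; set q := \sum_(i < n) b i ^+ 2.
set s := \sum_(i < n) a i * b i.
have p0 : 0 <= p by apply: sumr_ge0 => i _; exact: sqr_ge0.
have q0 : 0 <= q by apply: sumr_ge0 => i _; exact: sqr_ge0.
have E (u v : R) : 0 <= u ^+ 2 * p + u * v * s *+ 2 + v ^+ 2 * q.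
  have -> : u ^+ 2 * p + u * v * s *+ 2 + v ^+ 2 * q =
      \sum_(i < n) (u * a i + v * b i) ^+ 2.
    rewrite /p /q /s -mulrnAr -sumrMnl !mulr_sumr -!big_split/=.
    by apply: eq_bigr => i _; ring.
  by apply: sumr_ge0 => i _; exact: sqr_ge0.
rewrite -sqrtrM// (le_trans (ler_norm _))// -sqrtr_sqr ler_wsqrtr//.
have [q_eq0|q_neq0] := eqVneq q 0.
  have := E (- s) (p + 1); have := E 0 1; have := E (- 1) s.
  rewrite q_eq0 => h1 h2 h3; nra.
have q_gt0 : 0 < q by rewrite lt_neqAle eq_sym q_neq0.
rewrite -(ler_pM2l q_gt0) -subr_ge0.
have <- // : q ^+ 2 * p + q * - s * s *+ 2 + (- s) ^+ 2 * q =
  q * (p * q) - q * s ^+ 2 by ring.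
Qed.

Lemma euclidean_dist_triangle y x z :
  euclidean_dist x z <= euclidean_dist x y + euclidean_dist y z.
Proof.
rewrite /euclidean_dist.
set p := \sum_(i < n) (x ord0 i - y ord0 i) ^+ 2.
set q := \sum_(i < n) (y ord0 i - z ord0 i) ^+ 2.
have p0 : 0 <= p by apply: sumr_ge0 => i _; exact: sqr_ge0.
have q0 : 0 <= q by apply: sumr_ge0 => i _; exact: sqr_ge0.
rewrite -[leRHS]ger0_norm ?addr_ge0 ?sqrtr_ge0// -sqrtr_sqr ler_wsqrtr//.
rewrite sqrrD !sqr_sqrtr// addrAC.
have -> : \sum_(i < n) (x ord0 i - z ord0 i) ^+ 2 =
   p + q + (\sum_(i < n) (x ord0 i - y ord0 i) * (y ord0 i - z ord0 i)) *+ 2.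
  rewrite -sumrMnl -!big_split/=; apply: eq_bigr => i _; ring.
by rewrite lerD2l lerMn2r sum_cauchy_schwarz orbT.
Qed.

End EuclideanDistance.

HB.instance Definition _ (R : realType) (n : nat) :=
  Choice.copy (euclidean R n) 'rV[R]_n.
HB.instance Definition _ (R : realType) (n : nat) :=
  isMetric.Build R (euclidean R n) (@euclidean_dist_xx R n)
    (@euclidean_dist_eq0 R n) (@euclidean_dist_sym R n)
    (@euclidean_dist_triangle R n).

Section Dimensions.
Context (R : realType) (X : metricType R).
Implicit Types (A B U : set X) (r s delta : R).
Local Open Scope ereal_scope.

Definition diam U : \bar R :=
  ereal_sup (0 |` [set (mdist u.1 u.2)%:E | u in U `*` U]).

(* [diam U] to the power [s], where the empty set counts for 0 and any
   nonempty set for 1 when [s = 0] (the library has [0 `^ 0 = 1]). *)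
Definition diam_pow s U : \bar R :=
  if `[< U = set0 >] then 0 else diam U `^ s.

Definition hausdorff_premeasure s delta A : \bar R :=
  ereal_inf [set \sum_(0 <= i <oo) diam_pow s (U i) |
    U in [set U : (set X)^nat |
           A `<=` \bigcup_i U i /\ forall i, diam (U i) <= delta%:E]].

Definition hausdorff_measure s A : \bar R :=
  ereal_sup [set hausdorff_premeasure s delta A |
    delta in [set delta | (0 < delta)%R]].

Definition hausdorff_dim A : \bar R :=
  ereal_inf [set s%:E | s in
    [set s | (0 <= s)%R /\ hausdorff_measure s A = 0]].

(* [c] lists the centers. The library's [closed_ball] is the closure of an open
   ball, which in a metric space can be smaller than the closed ball. *)
Definition ball_cover B r (c : seq X) : Prop :=
  (forall x, x \in c -> B x) /\
  (forall y, B y -> exists2 x, x \in c & (mdist x y <= r)%R).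

Definition covering_number B r : \bar R :=
  ereal_inf [set (size c)%:R%:E | c in [set c | ball_cover B r c]].

Definition upper_box_dim B : \bar R :=
  if `[< B = set0 >] then 0
  else limf_esup (fun r => lne (covering_number B r) * ((ln r^-1)^-1)%:E) 0^'+.

End Dimensions.

Definition lipschitz_in (R : realType) (X Y : metricType R) (A : set X)
    (f : X -> Y) : Prop :=
  exists C : R, forall x z, A x -> A z -> mdist (f x) (f z) <= C * mdist x z.

(* Main.v *)
Require Import Defs.
From mathcomp Require Import all_boot all_order all_algebra.
From mathcomp Require Import all_classical all_reals all_analysis.
From mathcomp Require Import ring lra.

(* Let [dim_B B < t < s < dim_H A]. On a finite net of [A], a maximal measure
   [mu] with [mu (ball x r) <= r ^ s] has mass bounded below by the Hausdorff
   content of [A]. Fix a large [p] and scales [r_k] of ratio [2 (p + 1)], and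
   give a subset [E] at scale [r_k] the weight
   [sum_(y in E) mu y / mu (E /\ ball y r_k) ^ (1/p)].
   Carving balls of radius about [r_k / 2] out of [E], separated by [r_(k+1)],
   does not decrease the total weight, even when each piece counts for at most
   [(r_k / 2) ^ (s (1 - 1/p))]. If [s (1 - 1/p) > t], the weight therefore
   suffices to send every node of a tree of nets of [B] to its own subset of the
   net of [A], distinct nodes of level [k] being [r_k]-separated.

   Only the separation matters: mapping a point to the segments of the tree
   that join the leaf whose image is nearest to its ancestors, at a height
   given by the distance to that image, is Lipschitz on all of [X], with a
   constant that does not depend on the depth. This replaces Kirszbraun's and
   McShane's extension theorems. An ultrafilter limit of these maps covers
   [B]. *)

Set Implicit Arguments.
Unset Strict Implicit.
Unset Printing Implicit Defensive.

Import Order.TTheory GRing.Theory Num.Theory.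
Import numFieldNormedType.Exports.

Local Open Scope ring_scope.

(** * Weights and carving in finite metric spaces *)

Section FiniteMetric.
Context (R : realType) (T : finType) (d : T -> T -> R) (mu : T -> R).
Hypothesis dxx : forall x, d x x = 0.
Hypothesis dsym : forall x y, d x y = d y x.
Hypothesis dtri : forall y x z, d x z <= d x y + d y z.
Hypothesis mu_ge0 : forall x, 0 <= mu x.
Implicit Types (A E P Q S : {set T}) (x y z : T) (r g eta : R).

Definition fball x r : {set T} := [set y | d x y <= r].

Definition mass A : R := \sum_(x in A) mu x.

Definition weight eta E r A : R :=
  \sum_(y in A) mu y / mass (E :&: fball y r) `^ eta.

Definition separated r A P : Prop := {in A & P, forall y z, r < d y z}.

Lemma mass_ge0 A : 0 <= mass A.
Proof. by apply: sumr_ge0 => *; exact: mu_ge0. Qed.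

Lemma le_mass A P : A \subset P -> mass A <= mass P.
Proof.
move=> AP; rewrite /mass [leRHS](big_setID A)/= (finset.setIidPr AP) lerDl.
by apply: sumr_ge0 => *; exact: mu_ge0.
Qed.

Lemma mass_gt0 A x : x \in A -> 0 < mu x -> 0 < mass A.
Proof.
move=> xA mux; apply: lt_le_trans mux _.
by rewrite /mass (big_setD1 x)//= lerDl sumr_ge0// => *; exact: mu_ge0.
Qed.

Lemma weight_ge0 eta E r A : 0 <= weight eta E r A.
Proof. by apply: sumr_ge0 => y _; rewrite divr_ge0 ?powR_ge0. Qed.

Lemma weightU eta E r A P : [disjoint A & P] ->
  weight eta E r (A :|: P) = weight eta E r A + weight eta E r P.
Proof.
by move=> AP; rewrite /weight -bigU//; apply: eq_bigl => y; rewrite !inE.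
Qed.

Lemma weight_diff eta E r A P : P \subset A ->
  weight eta E r A = weight eta E r P + weight eta E r (A :\: P).
Proof.
by move=> PA; rewrite /weight [LHS](big_setID P)/= (finset.setIidPr PA).
Qed.

(* The balls of radius [r] around points of [A] do not reach [P]. *)
Lemma weight_separatedU eta r A P : 0 <= r -> separated r A P ->
  weight eta (A :|: P) r (A :|: P) = weight eta A r A + weight eta P r P.
Proof.
move=> r0 sep; rewrite weightU; last first.
  apply/pred0P => x /=; apply/negP => /andP[xA xP].
  by have := sep _ _ xA xP; rewrite dxx ltNge r0.
congr (_ + _); apply: eq_bigr => y yA; congr (_ / mass _ `^ _);
  apply/setP => z; rewrite !inE.
- case zP: (z \in P); rewrite ?orbF// orbT /=.
  by have := sep _ _ yA zP; rewrite ltNge => /negbTE ->; rewrite andbF.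
- case zA: (z \in A) => //=.
  by have := sep _ _ zA yA; rewrite dsym ltNge => /negbTE ->; rewrite andbF.
Qed.

(** Otherwise each of the [p] steps from [M 1] to [M p.+1] multiplies by more than the [p]-th root
    of [M p.+1 / M 1], and all of them together by too much. *)
Lemma growth_pigeonhole (p : nat) (M : nat -> R) : (0 < p)%N -> 0 < M 1%N ->
  (forall i, (0 < i)%N -> M i <= M i.+1) ->
  exists i : nat, [/\ (0 < i)%N, (i <= p)%N &
    M i.+1 / M p.+1 `^ p%:R^-1 <= M i / M 1%N `^ p%:R^-1].
Proof.
move=> p0 M1 Minc.
have Mpos i : (0 < i)%N -> 0 < M i.
  by case: i => // i _; elim: i => // i ih; exact: lt_le_trans ih (Minc _ _).
apply: contrapT => /forallNP no.
pose a := M p.+1 `^ p%:R^-1 / M 1%N `^ p%:R^-1.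
have a0 : 0 < a by rewrite divr_gt0 ?powR_gt0 ?Mpos.
have step i : (0 < i)%N -> (i <= p)%N -> a * M i < M i.+1.
  move=> i0 ip; rewrite ltNge; apply/negP => le.
  apply: (no i); split=> //; rewrite ler_pdivrMr ?powR_gt0 ?Mpos//.
  by rewrite (le_trans le)// /a mulrAC -mulrA mulrC.
have iterate i : (i < p)%N -> a ^+ i.+1 * M 1%N < M i.+2.
  elim: i => [|i ih] ip; first by rewrite expr1 step.
  rewrite exprS -mulrA (lt_trans _ (step i.+2 _ _))// ltr_pM2l// ih//.
  exact: ltnW.
have := iterate p.-1; rewrite prednK// leqnn => /(_ isT).
have pow_root c : 0 <= c -> (c `^ p%:R^-1) ^+ p = c.
  by move=> c0; rewrite -powR_mulrn ?powR_ge0// -powRrM mulVf ?powRr1//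
     pnatr_eq0 -lt0n.
by rewrite /a expr_div_n !pow_root ?ltW ?Mpos// divfK ?ltxx// gt_eqF.
Qed.

(* The center is a point of [S] whose [g]-ball in [S] has maximal mass; the
   radius [i * g] is chosen so that the mass does not grow much from [i * g] to
   [(i + 1) * g]. The loss is then bounded, at every point [y] of the removed
   ball, by the growth of the mass around [y] itself, from [g] to
   [2 (p + 1) g]; [weight] records the product of these losses over all
   scales. *)
Lemma carve (p : nat) E S g cap : (0 < p)%N -> 0 < g ->
  {in E, forall x, 0 < mu x} ->
  {in E, forall x,
    mass (E :&: fball x (p.+1%:R * g)) `^ (1 - p%:R^-1) <= cap} ->
  S \subset E -> S != finset.set0 ->
  exists P Q, [/\ P \subset Q, Q \subset S, Q != finset.set0,
    separated g P (S :\: Q) &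
    weight p%:R^-1 E (2 * p.+1%:R * g) Q <= weight p%:R^-1 P g P /\
    weight p%:R^-1 E (2 * p.+1%:R * g) Q <= cap].
Proof.
move=> p0 g0 mu0 Ecap SE /set0Pn[x0 x0S].
set eta := p%:R^-1.
have eta0 : 0 <= eta by rewrite invr_ge0.
pose x := [arg max_(x > x0 in S) mass (S :&: fball x g)]%O.
have [xS xmax] : x \in S /\
    {in S, forall y, mass (S :&: fball y g) <= mass (S :&: fball x g)}.
  by rewrite /x; case: arg_maxP => // i iS imax; split.
pose M i := mass (S :&: fball x (i%:R * g)).
have ball_mono i j : (i <= j)%N ->
    fball x (i%:R * g) \subset fball x (j%:R * g).
  move=> ij; apply/fintype.subsetP => y; rewrite !inE => /le_trans; apply.
  by rewrite ler_pM2r// ler_nat.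
have xball i : x \in S :&: fball x (i%:R * g).
  by rewrite !inE xS dxx mulr_ge0// ltW.
have mux : 0 < mu x by rewrite mu0// (fintype.subsetP SE).
have Mpos i : 0 < M i by exact: mass_gt0 (xball i) mux.
have [i [i0 ip Mi]] : exists i : nat, [/\ (0 < i)%N, (i <= p)%N &
    M i.+1 / M p.+1 `^ eta <= M i / M 1%N `^ eta].
  apply: growth_pigeonhole => // i i0.
  by apply: le_mass; apply: finset.setIS; apply: ball_mono.
exists (S :&: fball x (i%:R * g)), (S :&: fball x (i.+1%:R * g)).
(* As [i <= p], the ball of radius [2 (p + 1) g] around any point of the outer ball contains the
   [(p + 1) g]-ball around [x]; this bounds every denominator from below. *)
have QP : weight eta E (2 * p.+1%:R * g) (S :&: fball x (i.+1%:R * g)) <=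
    M i.+1 / M p.+1 `^ eta.
  rewrite {1}/M {1}/mass mulr_suml; apply: ler_sum => y;
    rewrite !inE => /andP[yS xy].
  rewrite ler_wpM2l// lef_pV2 ?posrE ?powR_gt0 ?Mpos//; last first.
    apply: (@mass_gt0 _ y); last by rewrite mu0// (fintype.subsetP SE).
    by rewrite !inE (fintype.subsetP SE)// dxx !mulr_ge0// ltW.
  rewrite ge0_ler_powR ?nnegrE ?mass_ge0//.
  apply: le_mass; apply/fintype.subsetP => z; rewrite !inE => /andP[zS xz].
  rewrite (fintype.subsetP SE)//= (le_trans (dtri x _ _))// dsym.
  rewrite -mulrA mulr_natl mulr2n lerD// (le_trans xy)// ler_pM2r//.
  by rewrite ler_nat ltnS.
split.
- by apply: finset.setIS; exact: ball_mono.
- exact: finset.subsetIl.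
- by apply/set0Pn; exists x.
- move=> y z; rewrite !inE => /andP[yS xy] /andP[+ zS].
  rewrite zS/= -ltNge => xz; rewrite ltNge; apply/negP => yz.
  have := dtri y x z; rewrite leNgt => /negP; apply.
  by rewrite (le_lt_trans _ xz)// -natr1 mulrDl mul1r lerD.
split; first rewrite (le_trans QP)// (le_trans Mi)//.
  rewrite {1}/M {1}/mass mulr_suml; apply: ler_sum => y yB.
  have /andP[yS xy] : (y \in S) && (d x y <= i%:R * g) by move: yB;
    rewrite !inE.
  rewrite ler_wpM2l// lef_pV2 ?posrE ?powR_gt0//; last first.
    apply: (@mass_gt0 _ y); last by rewrite mu0// (fintype.subsetP SE).
    by rewrite inE yB inE dxx ltW.
  rewrite ge0_ler_powR ?nnegrE ?mass_ge0//.
  (* No [g]-ball centered in [S] outweighs the one around [x], of mass [M 1]. *)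
  rewrite (@le_trans _ _ (mass (S :&: fball y g)))//.
    by apply: le_mass; apply: finset.setSI; exact: finset.subsetIl.
  by rewrite /M mul1r; exact: xmax.
rewrite (le_trans QP)//.
have Mle : M i.+1 / M p.+1 `^ eta <= M p.+1 `^ (1 - eta).
  rewrite powRB; last by rewrite (gt_eqF (Mpos _)) implybT.
  rewrite powRr1 ?mass_ge0// ler_wpM2r ?invr_ge0 ?powR_ge0//.
  by apply: le_mass; apply: finset.setIS; exact: ball_mono.
rewrite (le_trans Mle)// (le_trans _ (Ecap x _)) ?(fintype.subsetP SE)//.
rewrite ge0_ler_powR ?nnegrE ?mass_ge0//.
  by rewrite subr_ge0 /eta invf_le1 ?ler1n ?ltr0n.
by apply: le_mass; exact: finset.setSI.
Qed.

Section Children.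
Context (p : nat) (E : {set T}) (g cap : R).
Hypothesis p_gt0 : (0 < p)%N.
Hypothesis g_gt0 : 0 < g.
Hypothesis mu_gt0 : {in E, forall x, 0 < mu x}.
Hypothesis cap_ge0 : 0 <= cap.
Hypothesis le_cap :
  {in E, forall x, mass (E :&: fball x (p.+1%:R * g)) `^ (1 - p%:R^-1) <= cap}.

Let eta : R := p%:R^-1.
Let V S := weight eta E (2 * p.+1%:R * g) S.
Let W S := weight eta S g S.

(** Carve greedily until [a] is paid. A carved [Q] costs [V Q], and its core [P] adds at least as
    much to [W G]; since [V Q <= cap], the last piece overpays by at most [cap]. The bound
    [- cap <= a] lets the induction end on an overpaid demand. *)
Lemma carve_demand S (a : R) : S \subset E -> - cap <= a -> a <= V S ->
  exists G S' : {set T}, [/\ G \subset S, S' \subset S, separated g G S',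
    a <= W G &
    V S <= V S' + a + cap].
Proof.
have [n] := ubnP #|S|; elim: n S a => // n ih S a Sn SE capa aS.
have [a0|a0] := leP a 0.
  exists finset.set0, S; split=> //; first exact: finset.sub0set.
  - by move=> y z; rewrite inE.
  - by rewrite (le_trans a0)// weight_ge0.
  - by lra.
have S0 : S != finset.set0.
  by apply: contraTneq aS => ->; rewrite /V /weight big_set0 -ltNge.
have [P [Q [PQ QS Q0 sep [QW Qcap]]]] := carve p_gt0 g_gt0 mu_gt0 le_cap SE S0.
have VS : V S = V Q + V (S :\: Q) by exact: weight_diff.
have [||||G [S' [GS S'S sep' aW VS']]] := ih (S :\: Q) (a - V Q).
- apply: leq_trans (Sn : (#|S| <= n)%N); apply: proper_card.
  have /set0Pn[q qQ] := Q0; apply/properP; split; first exact: finset.subsetDl.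
  by exists q; rewrite ?(fintype.subsetP QS)// !inE qQ.
- by rewrite (fintype.subset_trans _ SE)// finset.subsetDl.
- by rewrite /V /eta; lra.
- by lra.
have SQS := finset.subsetDl S Q.
have PS := fintype.subset_trans PQ QS.
exists (P :|: G), S'; split.
- by rewrite finset.subUset PS (fintype.subset_trans GS).
- exact: fintype.subset_trans S'S SQS.
- move=> y z; rewrite inE => /orP[yP|yG] zS'; last exact: sep'.
  by apply: sep => //; exact: (fintype.subsetP S'S).
- rewrite /W weight_separatedU ?(ltW g_gt0)//; last first.
    by move=> y z yP zG; apply: sep => //; exact: (fintype.subsetP GS).
  by move: QW aW; rewrite /V /W /eta; lra.
- by lra.
Qed.

(** The children are served one after the other. Each uses up at most [dem q + cap] of [V], and the
    later ones take from a remainder [S'] separated from the earlier sets. *)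
Lemma carve_children (I : eqType) (qs : seq I) (dem : I -> R) S :
  (forall q, 0 <= dem q) -> S \subset E -> uniq qs ->
  \sum_(q <- qs) (dem q + cap) <= V S ->
  exists G : I -> {set T},
    {in qs, forall q, G q \subset S /\ dem q <= W (G q)} /\
    {in qs &, forall q q', q != q' -> separated g (G q) (G q')}.
Proof.
move=> dem0; elim: qs S => [|q qs ih] S SE.
  by move=> _ _; exists (fun=> finset.set0).
rewrite cons_uniq big_cons => /andP[qqs uqs] sumV.
have sum0 : 0 <= \sum_(q <- qs) (dem q + cap).
  by apply: sumr_ge0 => i _; rewrite addr_ge0.
have demq := dem0 q.
have [||G0 [S' [G0S S'S sep demW VS]]] := carve_demand (a := dem q) SE.
- have := cap_ge0; lra.
- have := cap_ge0; lra.
have [||G [GP Gsep]] := ih S' _ uqs.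
- exact: fintype.subset_trans SE.
- by lra.
exists (fun i => if i == q then G0 else G i); split.
  move=> i; rewrite inE; case: eqVneq => [-> _//|_ /= iqs].
  have [GS ?] := GP _ iqs; split=> //; exact: fintype.subset_trans S'S.
move=> i j; rewrite !inE; case: (eqVneq i q) => [->|_] /=.
  rewrite eq_sym => _; case: eqVneq => //= _ jqs _ y z yG zG; apply: sep => //.
  by have [/fintype.subsetP/(_ _ zG)] := GP _ jqs.
move=> iqs; case: eqVneq => //= [_ _ _ y z yG zG|_ jqs ij]; last exact: Gsep.
rewrite dsym; apply: sep => //.
by have [/fintype.subsetP/(_ _ yG)] := GP _ iqs.
Qed.

End Children.

Section Tree.
Context (Y : eqType) (c : nat -> seq Y) (par : nat -> Y -> Y) (root : Y).
Context (p n : nat) (E : {set T}) (r cap : nat -> R).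
Hypothesis c0 : c 0 = [:: root].
Hypothesis c_uniq : forall k, uniq (c k).
Hypothesis c_par : forall k q, q \in c k.+1 -> par k q \in c k.
Hypothesis p_gt0 : (0 < p)%N.
Hypothesis r_gt0 : forall k, 0 < r k.
Hypothesis rS : forall k, r k = 2 * p.+1%:R * r k.+1.
Hypothesis cap_gt0 : forall k, 0 < cap k.
Hypothesis mu_gt0 : {in E, forall x, 0 < mu x}.
Hypothesis le_cap : forall k, (k < n)%N -> {in E, forall x,
  mass (E :&: fball x (p.+1%:R * r k.+1)) `^ (1 - p%:R^-1) <= cap k}.

Fixpoint ancestor k j (q : Y) : Y :=
  if k is k'.+1 then if (j <= k')%N then ancestor k' j (par k' q) else q else q.

(* The weight that a set needs in order to receive the descendants of the
   node [q] of level [k] in the next [i] levels. *)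
Fixpoint demand i k (q : Y) : R :=
  if i is i'.+1 then
    \sum_(q' <- c k.+1 | par k q' == q) (demand i' k.+1 q' + cap k)
  else cap k.

Lemma demandS i k q : demand i.+1 k q =
  \sum_(q' <- c k.+1 | par k q' == q) (demand i k.+1 q' + cap k).
Proof. by []. Qed.

Lemma ancestor_id k q : ancestor k k q = q.
Proof. by case: k => //= k; rewrite ltnn. Qed.

Lemma ancestor_par k j q : (j < k)%N ->
  ancestor k j q = par j (ancestor k j.+1 q).
Proof.
elim: k q => // k ih q; rewrite ltnS /= => jk; rewrite jk.
by case: ltngtP jk => // [jk _|<- _]; rewrite ?ih ?ancestor_id.
Qed.

Lemma ancestor_mem k j q : q \in c k -> (j <= k)%N -> ancestor k j q \in c j.
Proof.
elim: k q => [|k ih] q qk; first by rewrite leqn0 => /eqP->.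
rewrite leq_eqVlt ltnS /= => /predU1P[->|jk]; first by rewrite ltnn.
by rewrite jk ih// c_par.
Qed.

Lemma demand_ge0 i k q : 0 <= demand i k q.
Proof.
elim: i k q => [|i ih] k q /=; first exact: ltW.
by apply: sumr_ge0 => q' _; rewrite addr_ge0// ltW.
Qed.

(** Each node of level [k.+1] has exactly one parent in [c k], so exchanging the sums over parents
    and children counts it once. Every node below level [k] costs one [cap], those of the last level
    a further one. *)
Lemma sum_demand i k : \sum_(q <- c k) demand i k q =
  \sum_(j < i) (size (c (k + j).+1))%:R * cap (k + j) +
  (size (c (k + i)))%:R * cap (k + i).
Proof.
elim: i k => [|i ih] k.
  by rewrite big_ord0 add0r addn0 big_const_seq count_predT iter_addr_0
    mulr_natl.
under eq_bigr do rewrite demandS.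
rewrite (exchange_big_dep predT)//= big_ord_recl/= addn0.
under [X in _ + X + _]eq_bigr do rewrite /bump/= add1n addnS -addSn.
rewrite addnS -addSn -addrA -ih.
rewrite mulr_natl -iter_addr_0 -count_predT -big_const_seq addrC -big_split/=.
rewrite big_seq [RHS]big_seq; apply: eq_bigr => q qk.
rewrite -big_filter (_ : [seq _ <- _ | _] = [:: par k q]) ?big_seq1//.
rewrite -(filter_pred1_uniq (c_uniq k) (c_par qk)); apply: eq_filter => y.
exact: eq_sym.
Qed.

Lemma r_decr j k : (j <= k)%N -> r k <= r j.
Proof.
move=> /subnK <-; elim: (k - j)%N => // i ih; apply: le_trans ih.
rewrite addSn [leRHS]rS ler_peMl ?(ltW (r_gt0 _))//.
by rewrite -natrM ler1n.
Qed.

Lemma tree_sets k : (k <= n)%N -> demand n 0 root <= weight p%:R^-1 E (r 0) E ->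
  exists G : Y -> {set T},
    {in c k, forall q, G q \subset E /\
       demand (n - k) k q <= weight p%:R^-1 (G q) (r k) (G q)} /\
    {in c k &, forall q q' j, (j <= k)%N -> ancestor k j q != ancestor k j q' ->
       separated (r j) (G q) (G q')}.
Proof.
elim: k => [|k ih] kn dem.
  exists (fun=> E); rewrite c0 subn0; split=> [q|q q'].
    by rewrite inE => /eqP ->.
  by rewrite !inE => /eqP -> /eqP -> j _ /=; rewrite eqxx.
have [G [GP Gsep]] := ih (ltnW kn) dem.
have /choice[F FP] : forall q, exists F : Y -> {set T}, q \in c k ->
    {in [seq q' <- c k.+1 | par k q' == q], forall q', F q' \subset G q /\
       demand (n - k.+1) k.+1 q' <= weight p%:R^-1 (F q') (r k.+1) (F q')} /\
    {in [seq q' <- c k.+1 | par k q' == q] &, forall q1 q2, q1 != q2 ->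
       separated (r k.+1) (F q1) (F q2)}.
  move=> q; have [qk|] := boolP (q \in c k); last by exists (fun=> finset.set0).
  have [GE Gdem] := GP _ qk.
  (* [G q] is both the ambient set and the set to carve: its weight is measured inside itself, and
     [rS] reads the radius [r k] as [2 (p + 1) r k.+1]. *)
  have [||||||F FP] := @carve_children p (G q) (r k.+1) (cap k) p_gt0 _ _ _ _
      _ [seq q' <- c k.+1 | par k q' == q] (demand (n - k.+1) k.+1) (G q)
      (demand_ge0 _ _) (fintype.subxx _) _ _.
  - exact: r_gt0.
  - by move=> x xG; apply: mu_gt0; exact: (fintype.subsetP GE).
  - exact: ltW.
  - move=> x xG; have xE := fintype.subsetP GE _ xG.
    apply: le_trans (le_cap kn xE); rewrite ge0_ler_powR ?nnegrE ?mass_ge0//.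
      by rewrite subr_ge0 invf_le1 ?ler1n ?ltr0n.
    by apply: le_mass; exact: finset.setSI.
  - by rewrite filter_uniq.
  - by rewrite big_filter -rS; move: Gdem; rewrite -subnSK.
  - by exists F.
exists (fun q => F (par k q) q); split=> [q qk|q q' qk q'k j].
  have [/(_ q) + _] := FP _ (c_par qk).
  rewrite mem_filter eqxx qk => /(_ isT)[FG ?]; split=> //.
  by apply: fintype.subset_trans FG _; have [] := GP _ (c_par qk).
have sub i : i \in c k.+1 -> F (par k i) i \subset G (par k i).
  move=> ik; have [/(_ i) + _] := FP _ (c_par ik).
  by rewrite mem_filter eqxx ik => /(_ isT)[].
have mono i : (i <= k)%N -> ancestor k i (par k q) != ancestor k i (par k q') ->
    separated (r i) (F (par k q) q) (F (par k q') q').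
  move=> ik nanc y z yF zF.
  apply: Gsep (c_par qk) (c_par q'k) _ ik nanc _ _ _ _.
  - exact: (fintype.subsetP (sub _ qk)).
  - exact: (fintype.subsetP (sub _ q'k)).
rewrite leq_eqVlt ltnS /= => /predU1P[->|jk]; last by rewrite jk; exact: mono.
(* Siblings are separated by the carving; nodes with different parents inherit the separation
   [r k >= r k.+1] of the parents' sets. *)
rewrite ltnn => qq'; have [pe|pn] := eqVneq (par k q) (par k q').
  have [_ Fsep] := FP _ (c_par qk); rewrite -pe.
  by apply: Fsep => //; rewrite mem_filter ?qk ?q'k ?pe eqxx.
move=> y z yF zF; apply: le_lt_trans (r_decr (leqnSn k)) _.
by apply: (mono k) => //; rewrite !ancestor_id.
Qed.

(** The demand left at level [n] is [cap n > 0], so every set has positive weight and hence a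
    point. *)
Lemma tree_embedding (x0 : T) : demand n 0 root <= weight p%:R^-1 E (r 0) E ->
  exists g : Y -> T, {in c n &, forall q q' j, (j <= n)%N ->
    ancestor n j q != ancestor n j q' -> r j < d (g q) (g q')}.
Proof.
move=> /(tree_sets (leqnn n))[G [GP Gsep]].
have /choice[g gP] : forall q, exists t : T, q \in c n -> t \in G q.
  move=> q; have [qn|_] := boolP (q \in c n); last by exists x0.
  have [_] := GP _ qn; rewrite subnn /= => le.
  have /set0Pn[t tG] : G q != finset.set0.
    apply: contraTneq le => ->.
    by rewrite /weight big_set0 -ltNge.
  by exists t.
exists g => q q' qn q'n j jn anc.
exact: (Gsep q q' _ _ j jn anc) (gP _ qn) (gP _ q'n).
Qed.

End Tree.

End FiniteMetric.

(** * Discrete Frostman measures *)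

(** Raise [mu] at one point after the other by the least slack [v j - mass mu (S j)] among the sets
    containing it. One of these becomes saturated; earlier saturated sets stay so, as one that
    contains the point makes the slack 0. *)
Lemma saturating_mass (R : realType) (T J : finType) (S : J -> {set T})
    (v : J -> R) : (forall j, 0 <= v j) -> (forall x, exists j, x \in S j) ->
  exists mu : T -> R, [/\ forall x, 0 <= mu x, forall j, mass mu (S j) <= v j &
    forall x, exists2 j, x \in S j & mass mu (S j) = v j].
Proof.
move=> v0 cov.
suff [mu [mu0 muv sat]] : exists mu : T -> R,
    [/\ forall x, 0 <= mu x, forall j, mass mu (S j) <= v j &
    {in enum T, forall x, exists2 j, x \in S j & mass mu (S j) = v j}].
  by exists mu; split=> // x; apply: sat; rewrite mem_enum.
elim: (enum T) => [|x s [mu [mu0 muv sat]]].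
  by exists (fun=> 0); split=> // j; rewrite /mass big1.
have [j0 xj0] := cov x.
pose j := [arg min_(j < j0 | x \in S j) (v j - mass mu (S j))]%O.
have [xj jmin] : x \in S j /\ forall i, x \in S i ->
    v j - mass mu (S j) <= v i - mass mu (S i).
  by rewrite /j; case: arg_minP => // i iS imin; split.
pose e := v j - mass mu (S j).
have e0 : 0 <= e by rewrite subr_ge0.
have massE i : mass (fun y => mu y + (if y == x then e else 0)) (S i) =
    mass mu (S i) + (if x \in S i then e else 0).
  rewrite /mass big_split/=; congr (_ + _); case: ifPn => xi.
    rewrite (bigD1 x)//= eqxx big1 ?addr0// => y /andP[_ /negbTE ->//].
  by rewrite big1// => y yi; case: eqVneq yi => // ->; rewrite (negbTE xi).
exists (fun y => mu y + (if y == x then e else 0)); split.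
- by move=> y; rewrite addr_ge0//; case: ifP.
- move=> i; rewrite massE; case: ifPn => xi; last by rewrite addr0.
  by have := jmin _ xi; rewrite -/e; lra.
- move=> y; rewrite inE => /predU1P[->|ys].
    by exists j => //; rewrite massE xj /e; lra.
  have [i yi satE] := sat _ ys; exists i => //; rewrite massE satE.
  case: ifPn => [xi|]; last by rewrite addr0.
  by have := jmin _ xi; rewrite -/e satE; lra.
Qed.

(** Choose a set with the largest [rad], discard all sets that meet it, and continue with the
    rest. *)
Lemma vitali_finite (R : realType) (T J : finType) (S : J -> {set T})
    (rad : J -> R) (F : {set J}) : (forall j, S j != finset.set0) ->
  exists G : {set J},
    [/\ G \subset F, {in G &, forall i j, i != j -> [disjoint S i & S j]} &
    {in F, forall i, exists j, [/\ j \in G, rad i <= rad j &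
       ~~ [disjoint S i & S j]]}].
Proof.
move=> S0; have [n] := ubnP #|F|; elim: n F => // n ih F Fn.
have [->|/set0Pn[j0 j0F]] := eqVneq F finset.set0.
  by exists finset.set0; split=> [|i j|j]; rewrite ?finset.sub0set ?inE.
pose j := [arg max_(j > j0 in F) rad j]%O.
have [jF jmax] : j \in F /\ {in F, forall i, rad i <= rad j}.
  by rewrite /j; case: arg_maxP => // i iF imax; split.
have Sjj : ~~ [disjoint S j & S j].
  by have /set0Pn[x xj] := S0 j; apply/pred0Pn; exists x; rewrite /= xj.
pose F' := [set i in F | [disjoint S i & S j]].
have F'F : F' \subset F by apply/fintype.subsetP => i; rewrite inE => /andP[].
have [|G [GF Gd Gc]] := ih F'.
  apply: leq_trans (Fn : (#|F| <= n)%N); apply: proper_card.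
  by apply/properP; split=> //; exists j; rewrite // inE jF.
have Gj i : i \in G -> [disjoint S i & S j].
  by move=> /(fintype.subsetP GF); rewrite inE => /andP[].
exists (j |: G); split.
- by rewrite finset.subUset finset.sub1set jF (fintype.subset_trans GF).
- move=> i k; rewrite !inE => /predU1P[->|iG] /predU1P[->|kG]; rewrite ?eqxx//.
  + by move=> _; rewrite disjoint_sym; exact: Gj.
  + by move=> _; exact: Gj.
  + exact: Gd.
- move=> i iF; have [dij|dij] := boolP [disjoint S i & S j].
    have [|k [kG ik dik]] := Gc i; first by rewrite inE iF.
    by exists k; rewrite !inE kG orbT.
  by exists j; rewrite !inE eqxx jmax.
Qed.

(* A maximal measure subject to the growth condition saturates a ball around
   every point; by the Vitali covering argument its mass is at least the cost
   of a covering. *)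
Lemma frostman_finite (R : realType) (T : finType) (d : T -> T -> R)
    (rho v : nat -> R) (n : nat) : (forall x, d x x = 0) ->
  (forall x y, d x y = d y x) -> (forall y x z, d x z <= d x y + d y z) ->
  (forall k, 0 <= rho k) -> (forall k, 0 <= v k) ->
  exists (mu : T -> R) (G : {set T * 'I_n.+1}),
    [/\ forall x, 0 <= mu x,
      forall x k, (k <= n)%N -> mass mu (fball d x (rho k)) <= v k,
      forall x, exists2 j, j \in G & d j.1 x <= 3 * rho j.2 &
      \sum_(j in G) v j.2 <= mass mu [set: T]].
Proof.
move=> dxx dsym dtri rho0 v0.
pose S (j : T * 'I_n.+1) := fball d j.1 (rho j.2).
have mem_center j : j.1 \in S j by rewrite inE dxx.
have [||mu [mu0 muv sat]] := @saturating_mass R T _ S (fun j => v j.2).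
- by move=> j; exact: v0.
- by move=> x; exists (x, ord0); exact: mem_center (x, ord0).
(* The selection is made among saturated balls, whose cost [v] is their mass; being disjoint, they
   cost at most the total mass. *)
have [|G [GF Gd Gc]] := @vitali_finite R T _ S (fun j => rho j.2)
    [set j | mass mu (S j) == v j.2].
  by move=> j; apply/set0Pn; exists j.1.
exists mu, G; split=> //.
- by move=> x k kn; have := muv (x, inord k); rewrite /S /= inordK.
- move=> x; have [i xi iv] := sat x.
  have [|j [jG ij]] := Gc i; first by rewrite inE iv.
  move=> /pred0Pn[z /= /andP[]]; rewrite !inE => zi zj; exists j => //.
  have := dtri z j.1 x; have := dtri i.1 z x; move: xi; rewrite inE => xi.
  by have := dsym i.1 z; lra.
- rewrite (eq_bigr (fun j => mass mu (S j))); last first.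
    by move=> j /(fintype.subsetP GF); rewrite inE => /eqP.
  rewrite /mass (exchange_big_dep predT)//=.
  rewrite [leRHS](eq_bigl predT); last by move=> x; rewrite inE.
  apply: ler_sum => x _; have [/existsP[j /andP[jG xj]]|no] :=
      boolP [exists j, (j \in G) && (x \in S j)].
    rewrite (bigD1 j) ?jG//= big1 ?addr0// => k /andP[/andP[kG xk] kj].
    by have /pred0P/(_ x) := Gd _ _ kG jG kj; rewrite /= xk xj.
  rewrite big_pred0// => j; apply: contraNF no => jx.
  by apply/existsP; exists j.
Qed.

Local Open Scope classical_set_scope.
Local Open Scope ring_scope.

(** * Lipschitz maps to trees of segments *)

Section Curve.
Context (R : realType) (Y : metricType R) (seg : Y -> Y -> R -> Y).
Hypothesis seg0 : forall u v, seg u v 0 = u.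
Hypothesis seg1 : forall u v, seg u v 1 = v.
Hypothesis seg_lip : forall u v a b,
  mdist (seg u v a) (seg u v b) <= `|a - b| * mdist u v.
Context (tau : nat -> R) (C : R).
Hypothesis C_ge0 : 0 <= C.
Hypothesis tau_gt0 : forall k, 0 < tau k.
Hypothesis tau_lt : forall k, tau k.+1 < tau k.
Implicit Types (z : nat -> Y) (a b t : R) (n k : nat).

(* The path through [z n, ..., z 0] that passes [z k] at time [tau k]. *)
Fixpoint curve z n t : Y :=
  if n is k.+1 then
    if tau k <= t then curve z k t
    else seg (z k) (z k.+1) (Num.min 1 ((tau k - t) / (tau k - tau k.+1)))
  else z 0.

(** [Num.min 1] holds the path at its last node at all times before [tau n]. *)
Lemma curve_start z n t : t <= tau n -> curve z n t = z n.
Proof.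
case: n => //= n tn; have lt := tau_lt n.
rewrite leNgt (le_lt_trans tn lt)/= min_l ?seg1//.
by rewrite ler_pdivlMr ?mul1r; lra.
Qed.

(** Each segment has length at most [C] times its duration, so the speed is at most [C]; an interval
    containing [tau n] is split there. *)
Lemma curve_lip z n a b :
  (forall k, (k < n)%N -> mdist (z k) (z k.+1) <= C * (tau k - tau k.+1)) ->
  mdist (curve z n a) (curve z n b) <= C * `|a - b|.
Proof.
move=> zC; wlog ab : a b / a <= b.
  move=> H; have [/H//|/ltW/H] := leP a b.
  by rewrite metric_sym distrC.
rewrite distrC ger0_norm ?subr_ge0//.
elim: n zC a b ab => [|n ih] zC a b ab.
  by rewrite /= mdistxx mulr_ge0// subr_ge0.
have {}ih := ih (fun k kn => zC k (ltnW kn)).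
have tau0 : 0 < tau n - tau n.+1 by rewrite subr_gt0.
pose la t := Num.min 1 ((tau n - t) / (tau n - tau n.+1)).
have seg_bound s t : s <= t ->
    mdist (seg (z n) (z n.+1) (la s)) (seg (z n) (z n.+1) (la t)) <=
    C * (t - s).
  move=> st; apply: le_trans (seg_lip _ _ _ _) _.
  have le : `|la s - la t| <= (t - s) / (tau n - tau n.+1).
    have st' : (tau n - t) / (tau n - tau n.+1) <=
        (tau n - s) / (tau n - tau n.+1).
      by rewrite ler_pM2r ?invr_gt0// lerD2l lerN2.
    have -> : (t - s) / (tau n - tau n.+1) =
      (tau n - s) / (tau n - tau n.+1) - (tau n - t) / (tau n - tau n.+1).
      by rewrite -mulrBl; congr (_ * _); ring.
    rewrite /la; move: st'; set x := _ / _; set y := _ / _ => xy.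
    rewrite /Num.min; case: ltP => ?; case: ltP => ?; rewrite ger0_norm; lra.
  apply: le_trans (ler_pM _ _ le (zC n (ltnSn n))) _ => //.
    exact: mdist_ge0.
  by rewrite mulrCA divfK ?gt_eqF.
rewrite /= -/(la a) -/(la b); case: (leP (tau n) a) => ta;
  case: (leP (tau n) b) => tb.
- exact: ih.
- by exfalso; lra.
- apply: le_trans (metric_triangle _ (z n) _) _.
  have -> : C * (b - a) = C * (tau n - a) + C * (b - tau n) by ring.
  apply: lerD.
    have la0 : la (tau n) = 0 by rewrite /la subrr mul0r min_r.
    by have := seg_bound _ _ (ltW ta); rewrite la0 seg0.
  by rewrite -{1}(@curve_start z n (tau n))// ih.
- exact: seg_bound.
Qed.

Lemma tau_le k n : (k <= n)%N -> tau n <= tau k.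
Proof.
move=> /subnK <-; elim: (n - k)%N => // i; apply: le_trans.
by rewrite addSn ltW.
Qed.

Lemma curve_stop z k n t : (k <= n)%N -> tau k <= t ->
  curve z n t = curve z k t.
Proof.
move=> kn kt; elim: n kn => [|n ih]; first by rewrite leqn0 => /eqP ->.
rewrite leq_eqVlt ltnS => /predU1P[-> //|kn] /=.
by rewrite (le_trans (tau_le kn) kt) ih.
Qed.

Lemma eq_curve z z' n t : (forall k, (k <= n)%N -> z k = z' k) ->
  curve z n t = curve z' n t.
Proof.
elim: n => [|n ih] zz' /=; first exact: zz'.
by rewrite !zz'// ih// => k kn; rewrite zz'// ltnW.
Qed.

Lemma curve_mem (B : set Y) z n t : (forall k, (k <= n)%N -> B (z k)) ->
  exists u v a, [/\ B u, B v, 0 <= a <= 1 & curve z n t = seg u v a].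
Proof.
elim: n => [|n ih] zB /=.
  by exists (z 0), (z 0), 0; rewrite seg0 lexx ler01; split=> //; exact: zB.
have [_|nt] := leP (tau n) t; first by apply: ih => k kn; exact/zB/ltnW.
exists (z n), (z n.+1), (Num.min 1 ((tau n - t) / (tau n - tau n.+1))).
split=> //; try exact: zB.
rewrite ge_min lexx/= andbT le_min ler01/= divr_ge0// subr_ge0 ltW//.
Qed.

(* Points outside the tree are sent to the path of a nearest leaf, at the time
   given by the distance to that leaf; two such paths coincide after a time
   controlled by the distance of the leaves. *)
Lemma tree_extension (X : metricType R) (L : eqType) (leaves : seq L)
    (z : L -> nat -> Y) (g : L -> X) (n : nat) (B : set Y) :
  leaves != [::] ->
  {in leaves, forall u k, (k <= n)%N -> B (z u k)} ->
  {in leaves, forall u k, (k < n)%N ->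
    mdist (z u k) (z u k.+1) <= C * (tau k - tau k.+1)} ->
  {in leaves &, forall u v, z u 0 = z v 0} ->
  {in leaves &, forall u v k, (k < n)%N -> z u k.+1 != z v k.+1 ->
    4 * tau k < mdist (g u) (g v)} ->
  exists f : X -> Y,
    [/\ forall x y, mdist (f x) (f y) <= 3 * C * mdist x y,
      forall x, exists u v a, [/\ B u, B v, 0 <= a <= 1 & f x = seg u v a] &
      {in leaves, forall u, f (g u) = z u n}].
Proof.
move=> leaves0 zB zC z0 sep.
have /choice[near nearP] : forall x, exists u, u \in leaves /\
    {in leaves, forall v, mdist x (g u) <= mdist x (g v)}.
  move=> x; elim: leaves leaves0 {zB zC z0 sep} => // u s ih _.
  have [->|/ih[v [vs vmin]]] := eqVneq s [::].
    by exists u; split; rewrite ?inE// => w; rewrite inE => /eqP ->.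
  have [uv|vu] := leP (mdist x (g u)) (mdist x (g v)).
    exists u; split; rewrite ?mem_head// => w;
      rewrite inE => /predU1P[->//|/vmin].
    exact: le_trans.
  exists v; split; rewrite ?inE ?vs ?orbT// => w.
  by rewrite inE => /predU1P[->|/vmin//]; exact: ltW.
pose f x := curve (z (near x)) n (mdist x (g (near x))).
(* Either the paths of the two leaves coincide, or [k.+1] is the first level where they differ, and
   [sep] applies there. *)
have sep_min u v : u \in leaves -> v \in leaves ->
    (forall k, (k <= n)%N -> z u k = z v k) \/ exists k, [/\ (k < n)%N,
      4 * tau k < mdist (g u) (g v) & forall i, (i <= k)%N -> z u i = z v i].
  move=> ul vl; have [ex|nex] := pselect (exists k,
    (k <= n)%N && (z u k != z v k)).
    right; case: (ex_minnP ex) => [[|k]] /andP[kn zk] kmin.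
      by rewrite (z0 _ _ ul vl) eqxx in zk.
    exists k; split=> //; first exact: sep.
    move=> i ik; apply/eqP; rewrite -[_ == _]negbK; apply/negP => zi.
    have := kmin i; rewrite zi andbT (leq_trans ik (ltnW kn)) ltnNge ik.
    by move=> /(_ isT).
  left=> k kn; apply/eqP; rewrite -[_ == _]negbK; apply/negP => zk.
  by apply: nex; exists k; rewrite kn.
have fC : {in leaves, forall u, forall a b,
    mdist (curve (z u) n a) (curve (z u) n b) <= C * `|a - b|}.
  by move=> u ul a b; apply: curve_lip => k; exact: zC.
exists f; split.
- move=> x y; have [xl xmin] := nearP x; have [yl ymin] := nearP y.
  rewrite /f; set u := near x in xl xmin *; set v := near y in yl ymin *.
  set a := mdist x (g u); set b := mdist y (g v).
  have ab : a <= mdist x y + b.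
    by apply: le_trans (xmin _ yl) _; exact: metric_triangle.
  have ba : b <= mdist x y + a.
    by apply: le_trans (ymin _ xl) _; rewrite [mdist x y]metric_sym
      metric_triangle.
  have abn : `|a - b| <= mdist x y by rewrite ler_norml; apply/andP; split; lra.
  have xy0 : 0 <= mdist x y := mdist_ge0 x y.
  have b0 : 0 <= b := mdist_ge0 _ _.
  have a0 : 0 <= a := mdist_ge0 _ _.
  have [zuv|[k [kn far zuv]]] := sep_min u v xl yl.
    rewrite (eq_curve _ zuv); apply: le_trans (fC _ yl _ _) _.
    rewrite -mulrA mulrCA ler_wpM2l//; lra.
  (* The paths agree from time [tau k] on, hence at [m]. The times [|a - m|] and [|b - m|] add up to
     [|a - b|], unless [tau k] exceeds both [a] and [b]; then [far2] bounds their sum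
     [2 tau k - a - b] by [mdist x y]. *)
  pose m := Num.max a (tau k).
  have um : curve (z u) n m = curve (z v) n m.
    rewrite !(@curve_stop _ k n m) ?(ltnW kn)//;
      try by rewrite le_max lexx orbT.
    exact: eq_curve.
  apply: le_trans (metric_triangle _ (curve (z u) n m) _) _.
  apply: le_trans (lerD (fC _ xl _ _) (le_refl _)) _.
  rewrite um; apply: le_trans (lerD (le_refl _) (fC _ yl _ _)) _.
  rewrite -mulrDr -mulrA mulrCA ler_wpM2l//.
  have far2 : 4 * tau k < a + mdist x y + b.
    apply: lt_le_trans far _; apply: le_trans (metric_triangle _ x _) _.
    rewrite metric_sym -/a -addrA lerD2l.
    exact: metric_triangle.
  have tk := tau_gt0 k.
  rewrite /m; case: (leP a (tau k)) => atk.
    have -> : `|a - tau k| = tau k - a by rewrite distrC ger0_norm// subr_ge0.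
    clear um m; clearbody a b; case: (lerP (tau k) b) => h; lra.
  by rewrite subrr normr0 add0r; lra.
- move=> x; have [xl _] := nearP x; apply: curve_mem; exact: zB.
- move=> u ul; rewrite /f; have [vl vmin] := nearP (g u).
  (* The leaf nearest to [g u] is at distance 0, so [sep] makes its path that of [u]; at time 0 this
     path is at its end. *)
  set v := near (g u) in vl vmin *.
  have duv : mdist (g u) (g v) = 0.
    apply/eqP; rewrite eq_le mdist_ge0 andbT.
    by apply: le_trans (vmin _ ul) _; rewrite mdistxx.
  rewrite duv (curve_start _ (ltW (tau_gt0 n))).
  have [zuv|[k [_ + _]]] := sep_min u v ul vl; first by rewrite zuv.
  by rewrite duv => ?; exfalso; have := tau_gt0 k; lra.
Qed.

End Curve.

(** * Compactness, finite nets and limits along an ultrafilter *)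

Lemma ultra_compact_cvg (S : topologicalType) (I : Type) (U : set_system I)
    (K : set S) (u : I -> S) : UltraFilter U -> compact K ->
  (forall i, K (u i)) ->
  exists2 p, K p & u @ U --> p.
Proof.
move=> UU cK Ku; have UF : ProperFilter U by exact: ultra_proper.
have [|p [Kp clp]] := cK (u @ U) _.
  by apply: (@filterE _ U) => i; exact: Ku.
exists p => // N pN.
have [//|UNc] := in_ultra_setVsetC (u @^-1` N) UU.
have [x [xNc xN]] := clp (~` N) N UNc pN.
by [].
Qed.

(** Without a finite net the sets [away s] would generate a proper filter; but a cluster point [p]
    of it has a ball disjoint from [away [:: p]]. *)
Lemma compact_net (R : realType) (X : metricType R) (A : set X) (e : R) :
  compact A -> 0 < e -> exists s : seq X, (forall x, x \in s -> A x) /\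
    (forall a, A a -> exists2 x, x \in s & mdist x a < e).
Proof.
move=> cA e0; apply: contrapT => /forallNP no.
pose D := [set s : seq X | forall x, x \in s -> A x].
pose away (s : seq X) := [set a | A a /\ forall x, x \in s -> e <= mdist x a].
have FF : ProperFilter (filter_from D away).
  apply: filter_from_proper.
    apply: filter_from_filter; first by exists [::].
    move=> s t sA tA; exists (s ++ t).
      by move=> x; rewrite mem_cat => /orP[/sA|/tA].
    by move=> a [Aa far]; split; split=> // x xs; apply: far;
      rewrite mem_cat xs ?orbT.
  move=> s sA; apply: contrapT => /nonemptyPn s0; apply: (no s);
    split=> // a Aa.
  apply: contrapT => /forall2NP near.
  suff : away s a by rewrite s0.
  by split=> // x xs; rewrite leNgt; apply/negP => xa; have [] := near x.
have [|p [Ap clp]] := cA (filter_from D away) FF.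
  by exists [::] => // a [].
have [|a [[_ far] pa]] := clp (away [:: p]) (ball p e) _ (nbhsx_ballx p e e0).
  by exists [:: p] => // x; rewrite inE => /eqP ->.
by have := far p (mem_head _ _); move: pa; rewrite ballEmdist/= ltNge => /negP.
Qed.

(** Bounded sets of [Y] may fail to be relatively compact, but [f_ n x] lies on a segment with ends
    in [B]: its ends and its parameter range over compact sets, so they converge along an
    ultrafilter, the same for all [x]. *)
Lemma compact_lipschitz_limit (R : realType) (X Y : metricType R)
    (seg : Y -> Y -> R -> Y) (A : set X) (B : set Y) (C : R)
    (f_ : nat -> X -> Y)
    (e : nat -> R) :
  (forall u v a b, mdist (seg u v a) (seg u v b) <= `|a - b| * mdist u v) ->
  (forall u v u' v' a, 0 <= a <= 1 ->
     mdist (seg u v a) (seg u' v' a) <= mdist u u' + mdist v v') ->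
  compact A -> compact B -> 0 <= C ->
  (forall n x y, mdist (f_ n x) (f_ n y) <= C * mdist x y) ->
  (forall n x, exists u v a, [/\ B u, B v, 0 <= a <= 1 & f_ n x = seg u v a]) ->
  (forall n b, B b -> exists2 x, A x & mdist (f_ n x) b <= e n) ->
  e @ \oo --> 0 ->
  exists f : X -> Y, lipschitz_in A f /\ B `<=` f @` A.
Proof.
move=> seg_lip seg_dist cA cB C0 fC fseg fB e0.
have [U [UU oU]] := ultraFilterLemma (F := \oo) _.
have UF : ProperFilter U by exact: ultra_proper.
have mnear (Z : metricType R) (u : nat -> Z) (p : Z) :
    u @ U --> p -> forall d, 0 < d -> \forall n \near U, mdist p (u n) < d.
  move=> up d d0; have := up _ (nbhsx_ballx p d d0).
  by rewrite ballEmdist.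
have /choice[f flim] : forall x, exists y, forall d, 0 < d ->
    \forall n \near U, mdist y (f_ n x) < d.
  move=> x; have /choice[w wP] : forall n, exists w : Y * Y * R,
      [/\ B w.1.1, B w.1.2, w.2 \in `[0, 1] & f_ n x = seg w.1.1 w.1.2 w.2].
    move=> n; have [u [v [a [Bu Bv a01 ->]]]] := fseg n x.
    by exists (u, v, a); split.
  have [|u Bu wu] := ultra_compact_cvg UU cB (u := fun n => (w n).1.1).
    by move=> n; have [] := wP n.
  have [|v Bv wv] := ultra_compact_cvg UU cB (u := fun n => (w n).1.2).
    by move=> n; have [] := wP n.
  have [|a a01 wa] := ultra_compact_cvg UU (@segment_compact R 0 1)
      (u := fun n => (w n).2).
    by move=> n; have [] := wP n.
  exists (seg u v a) => d d0.
  have d3 : 0 < d / 3 by rewrite divr_gt0.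
  have m0 : 0 < 1 + mdist u v by rewrite ltr_wpDr// mdist_ge0.
  have dm : 0 < d / 3 / (1 + mdist u v) by rewrite divr_gt0.
  have na : \forall n \near U, `|a - (w n).2| < d / 3 / (1 + mdist u v).
    exact: (wa _ (nbhsx_ballx a _ dm)).
  near=> n.
  have un : mdist u (w n).1.1 < d / 3 by near: n; exact: (mnear _ _ _ wu _ d3).
  have vn : mdist v (w n).1.2 < d / 3 by near: n; exact: (mnear _ _ _ wv _ d3).
  have an : `|a - (w n).2| < d / 3 / (1 + mdist u v) by near: n.
  have [_ _ + ->] := wP n; rewrite in_itv/= => w01.
  apply: le_lt_trans (metric_triangle _ (seg u v (w n).2) _) _.
  have s1 := seg_lip u v a (w n).2.
  have s2 := seg_dist u v (w n).1.1 (w n).1.2 _ w01.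
  have s3 : `|a - (w n).2| * mdist u v <= d / 3.
    apply: le_trans (_ : d / 3 / (1 + mdist u v) * (1 + mdist u v) <= _).
      by rewrite ler_pM// ?mdist_ge0 ?ltW// ltrDr.
    by rewrite divfK ?gt_eqF.
  lra.
exists f; split.
  exists C => x y _ _; apply/ler_addgt0Pr => d d0.
  have d2 : 0 < d / 2 by rewrite divr_gt0.
  have [n [xn yn]] := filter_ex (filterI (flim x _ d2) (flim y _ d2)).
  have := metric_triangle (f x) (f_ n x) (f y).
  have := metric_triangle (f_ n x) (f_ n y) (f y).
  have := fC n x y; rewrite [mdist (f_ n y) _]metric_sym; lra.
(* Points of [A] that [f_ n] sends close to [b] converge along the ultrafilter to some [x]; the
   common constant [C] gives [f x = b]. *)
move=> b Bb; have /choice[a aP] : forall n, exists a,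
  A a /\ mdist (f_ n a) b <= e n.
  by move=> n; have [a Aa ab] := fB n b Bb; exists a.
have [|x Ax ax] := ultra_compact_cvg UU cA (u := a).
  by move=> n; have [] := aP n.
exists x => //; apply: mdist_positivity; apply/eqP;
  rewrite eq_le mdist_ge0 andbT.
apply/ler_addgt0Pr => d d0; rewrite add0r.
have d3 : 0 < d / 3 by rewrite divr_gt0.
have dC : 0 < d / 3 / (1 + C) by rewrite divr_gt0// ltr_pwDl.
have en : \forall n \near U, `|0 - e n| < d / 3.
  by apply: oU; exact: (e0 _ (nbhsx_ballx (0 : R) _ d3)).
have [n [[xn an] en']] :=
  filter_ex (filterI (filterI (flim x _ d3) (mnear _ _ _ ax _ dC)) en).
have [_ ab] := aP n.
have t1 := metric_triangle (f x) (f_ n x) b.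
have t2 := metric_triangle (f_ n x) (f_ n (a n)) b.
have t3 := fC n x (a n).
have t4 : C * mdist x (a n) <= d / 3.
  apply: le_trans (_ : (1 + C) * (d / 3 / (1 + C)) <= _).
    by rewrite ler_pM ?mdist_ge0 ?lerDr ?(ltW an)//.
  by rewrite mulrCA divff ?mulr1// gt_eqF// ltr_pwDl.
have := ler_norm (- (0 - e n)); rewrite normrN => t5.
lra.
Unshelve. all: by end_near. Qed.

(** * Dimensions, nets and measures *)

Section Content.
Context (R : realType) (X : metricType R).
Implicit Types (A B : set X) (s t r delta : R).

Lemma diam_pow_ge0 s (U : set X) : (0 <= diam_pow s U)%E.
Proof. by rewrite /diam_pow; case: asboolP => // _; exact: poweR_ge0. Qed.

Lemma hausdorff_premeasure_ge0 s delta A :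
  (0 <= hausdorff_premeasure s delta A)%E.
Proof.
apply: le_ereal_inf_tmp => _ [U _ <-].
by apply: nneseries_ge0 => i _ _; exact: diam_pow_ge0.
Qed.

Lemma diam_ball (x : X) r : 0 <= r ->
  (diam [set y | (mdist x y <= r)%R] <= (2 * r)%:E)%E.
Proof.
move=> r0; apply: ge_ereal_sup => _ [->|[[y z] [/= xy xz] <-]].
  by rewrite lee_fin mulr_ge0.
rewrite lee_fin (le_trans (metric_triangle _ x _))//= metric_sym.
by rewrite mulr_natl mulr2n lerD.
Qed.

Lemma diam_ge0 (U : set X) : (0 <= diam U)%E.
Proof. by apply: ereal_sup_ubound; left. Qed.

(** A finite list of balls becomes a countable cover when continued by empty sets, which [diam_pow]
    counts for 0. *)
Lemma hausdorff_premeasure_le_sum s delta A (cov : seq (X * R)) : 0 < s ->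
  (0 <= delta) ->
  {in cov, forall w, 0 <= w.2 /\ 2 * w.2 <= delta} ->
  (forall a, A a -> exists2 w, w \in cov & mdist w.1 a <= w.2) ->
  (hausdorff_premeasure s delta A <= (\sum_(w <- cov) (2 * w.2) `^ s)%:E)%E.
Proof.
move=> s0 delta0 small covA.
pose U i := [set y | exists w, onth cov i = Some w /\ mdist w.1 y <= w.2].
have UE w i : (i < size cov)%N ->
    U i = [set y | mdist (nth w cov i).1 y <= (nth w cov i).2].
  move=> ic; apply/seteqP; split=> y.
    by move=> [v [/(onth_nth w) ->]].
  move=> /= wy; exists (nth w cov i); split=> //; move: ic; rewrite -onthTE.
  by case E : (onth cov i) => // _; rewrite (@onth_nth _ w _ _ _ E).
have U0 i : (size cov <= i)%N -> U i = set0.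
  by move=> ci; apply/seteqP; split=> // y [w []]; rewrite onth_default.
have Usmall i : (diam (U i) <= delta%:E)%E.
  have [ic|ci] := ltnP i (size cov); last first.
    rewrite (U0 _ ci); apply: ge_ereal_sup => _ [->|[[y z] [[]]]].
    by rewrite lee_fin.
  have [w] : exists w, onth cov i = Some w.
    by move: ic; rewrite -onthTE; case: (onth cov i) => // w _; exists w.
  move=> wi; have := mem_nth w ic; rewrite (UE w _ ic).
  by move=> /small[r0 r2]; apply: le_trans (diam_ball _ r0) _; rewrite lee_fin.
have Upow w i : (i < size cov)%N ->
    (diam_pow s (U i) <= ((2 * (nth w cov i).2) `^ s)%:E)%E.
  move=> ic; rewrite /diam_pow; case: asboolP => _.
    by rewrite lee_fin powR_ge0.
  have [r0 _] := small _ (mem_nth w ic).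
  rewrite -poweR_EFin (gt0_ler_poweR (ltW s0))//.
  - by rewrite in_itv/= diam_ge0 leey.
  - by rewrite in_itv/= lee_fin leey andbT mulr_ge0.
  - by rewrite (UE w _ ic) diam_ball.
apply: le_trans (_ : (\sum_(0 <= i <oo) diam_pow s (U i) <= _)%E).
  apply: ereal_inf_lbound; exists U => //; split=> // a /covA[w wcov wa].
  have /onthP[i iw] := wcov.
  by exists i => //; exists w.
rewrite (nneseries_split 0 (size cov)); last by move=> k _; exact: diam_pow_ge0.
rewrite add0n eseries0 ?adde0; last first.
  by move=> i ci _; rewrite (U0 _ ci) /diam_pow; case: asboolP.
have [c0|[w0 _]] : cov = [::] \/ exists w0 : X * R, True.
  by case: (cov) => [|w0 ?]; [left | right; exists w0].
  by rewrite c0 /= big_geq// big_nil.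
rewrite -sumEFin (big_nth w0) !big_nat; apply: lee_sum => i /andP[_ ic].
exact: Upow.
Qed.

(** Below the dimension the Hausdorff measure is not 0, so some premeasure is positive; [c] is a
    positive real not above it, as it may be infinite. *)
Lemma hausdorff_content A s : 0 < s -> (s%:E < hausdorff_dim A)%E ->
  exists c delta, [/\ 0 < c, 0 < delta & forall cov : seq (X * R),
    {in cov, forall w, 0 <= w.2 /\ 2 * w.2 <= delta} ->
    (forall a, A a -> exists2 w, w \in cov & mdist w.1 a <= w.2) ->
    c <= \sum_(w <- cov) (2 * w.2) `^ s].
Proof.
move=> s0 sdim.
have [delta delta0 prem] : exists2 delta, 0 < delta &
    (0 < hausdorff_premeasure s delta A)%E.
  apply: contrapT => /forall2NP no; move: sdim; rewrite ltNge => /negP; apply.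
  apply: ereal_inf_lbound; exists s => //; split; first exact: ltW.
  apply/eqP; rewrite eq_le; apply/andP; split.
    apply: ge_ereal_sup => _ [delta delta0 <-].
    by rewrite leNgt; apply/negP => ?; have [] := no delta.
  apply: le_trans (hausdorff_premeasure_ge0 s 1 A) _.
  by apply: ereal_sup_ubound; exists 1 => //=; exact: ltr01.
have [c c0 cle] : exists2 c, 0 < c & (c%:E <= hausdorff_premeasure s delta A)%E.
  move: prem; case: (hausdorff_premeasure s delta A) => [c||] //.
    by rewrite lte_fin; exists c.
  by exists 1; rewrite ?leey.
exists c, delta; split=> // cov small covA; rewrite -lee_fin.
exact: le_trans cle (hausdorff_premeasure_le_sum s0 (ltW delta0) small covA).
Qed.

Lemma covering_number_ge1 B r : B !=set0 -> (1 <= covering_number B r)%E.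
Proof.
move=> [b Bb]; apply: le_ereal_inf_tmp => _ [c [_ cov] <-].
by have [x] := cov b Bb; rewrite lee_fin ler1n; case: c {cov}.
Qed.

Lemma upper_box_dim_ge0 B : B !=set0 -> (0 <= upper_box_dim B)%E.
Proof.
move=> B0; rewrite /upper_box_dim; case: asboolP => // _.
apply: le_ereal_inf_tmp => _ [V Vn <-].
have [r [Vr [r0 r1]]] := filter_ex (filterI Vn
  (filterI (nbhs_right_gt (0 : R)) (nbhs_right_lt (@ltr01 R)))).
apply: le_ereal_sup_tmp; eexists; first by exists r.
apply: mule_ge0; first by rewrite lne_ge0 covering_number_ge1.
by rewrite lee_fin invr_ge0 ln_ge0// invf_ge1// ltW.
Qed.

(** A limit superior below [t] bounds [covering_number B r] strictly for all small [r], and an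
    infimum strictly below a bound comes with a list of centers that meets it. *)
Lemma upper_box_dim_cover B t : B !=set0 -> (upper_box_dim B < t%:E)%E ->
  exists2 e, 0 < e & forall r, 0 < r -> r < e ->
    exists2 c : seq X, ball_cover B r c & (size c)%:R <= r^-1 `^ t.
Proof.
move=> B0; rewrite /upper_box_dim; case: asboolP => [BE|_].
  by move: B0; rewrite BE => -[].
move=> /ereal_inf_lt[_ [V Vn <-] Vt].
have [e /= e0 eV] := Vn.
exists (Num.min e 1) => [|r r0]; first by rewrite lt_min ltr01 andbT.
rewrite lt_min => /andP[re r1].
have Vr : V r by apply: eV => //=; rewrite sub0r normrN gtr0_norm.
have L0 : 0 < ln r^-1 by rewrite ln_gt0// invf_gt1.
have : (lne (covering_number B r) * ((ln r^-1)^-1)%:E < t%:E)%E.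
  apply: le_lt_trans Vt; apply: ereal_sup_ubound.
  by exists r.
rewrite lte_pdivrMr// -EFinM => Nt.
have : (covering_number B r < ((r^-1) `^ t)%:E)%E.
  rewrite /powR gt_eqF ?invr_gt0//; move: Nt (covering_number_ge1 r B0).
  case: (covering_number B r) => [N||] // + N1.
  rewrite lee_fin in N1.
  have N0 : 0 < N by lra.
  by rewrite lne_EFin// !lte_fin => ?; rewrite -[N]lnK ?posrE// ltr_expR.
move=> /ereal_inf_lt[_ [c Bc <-]]; rewrite lte_fin => /ltW ?.
by exists c.
Qed.

End Content.

(** The measure lives on a net of [A] of mesh [rho n]. The selected balls, tripled and enlarged by
    this mesh, cover [A], so the Hausdorff content bounds the mass from below, by a constant
    independent of [rho] and [n]. *)
Lemma frostman_compact (R : realType) (X : metricType R) (A : set X) (s : R) :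
  compact A -> 0 < s -> (s%:E < hausdorff_dim A)%E ->
  exists c delta, [/\ 0 < c, 0 < delta & forall (rho : nat -> R) (n : nat),
    (forall k, 0 < rho k) ->
    (forall k, (k <= n)%N -> rho n <= rho k <= delta) ->
    exists (T : finType) (h : T -> X) (mu : T -> R),
      [/\ forall x, A (h x), forall x, 0 <= mu x,
        forall x k, (k <= n)%N ->
          mass mu (fball (fun x y => mdist (h x) (h y)) x (rho k)) <=
          rho k `^ s &
        c <= mass mu [set: T]]].
Proof.
move=> cA s0 sdim; have [c [delta [c0 delta0 content]]] := hausdorff_content s0
  sdim.
(* Balls of radius [4 rho] have diameter at most [8 rho], whence both factors. *)
exists (c / 8 `^ s), (delta / 8); split; rewrite ?divr_gt0 ?powR_gt0// => rho n
  rho0 rhon.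
have [l [lA lnet]] := compact_net cA (rho0 n).
pose d (x y : seq_sub l) := mdist (ssval x) (ssval y).
have [|||||mu [G [mu0 mu_rho Gcov Gsum]]] :=
  @frostman_finite R (seq_sub l) d rho (fun k => rho k `^ s) n.
- by move=> x; exact: mdistxx.
- by move=> x y; exact: metric_sym.
- by move=> y x z; exact: metric_triangle.
- by move=> k; exact: ltW.
- by move=> k; exact: powR_ge0.
exists (seq_sub l), (fun x : seq_sub l => ssval x), mu; split=> //.
  by move=> x; exact/lA/ssvalP.
rewrite ler_pdivrMr ?powR_gt0//.
pose cov : seq (X * R) := [seq (ssval j.1, 4 * rho j.2) | j :
  seq_sub l * 'I_n.+1 <- enum G].
apply: (le_trans (content cov _ _)).
- move=> _ /mapP[j _ ->] /=; have /andP[_ rd] := rhon j.2 (ltn_ord j.2).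
  by have := rho0 j.2; split; lra.
- move=> a /lnet[x xl xa]; have [j jG jx] := Gcov (SeqSub xl).
  exists (ssval j.1, 4 * rho j.2); first by apply: map_f; rewrite mem_enum.
  have /andP[rn _] := rhon j.2 (ltn_ord j.2).
  by have := metric_triangle (ssval j.1) x a; rewrite /d/= in jx *; lra.
- rewrite big_map big_enum/= mulrC.
  apply: le_trans (ler_wpM2l (powR_ge0 _ _) Gsum); rewrite mulr_sumr.
  apply: ler_sum => j _; rewrite -powRM ?(ltW (rho0 _))//.
  by rewrite mulrA -natrM.
Qed.

(** Level [k.+1] is a net of mesh [D ^ -(m + k.+1)], with parents picked in the net above; level 0
    is a single point, the root of the tree. *)
Lemma box_nets (R : realType) (Y : metricType R) (B : set Y) (t D : R) :
  B !=set0 -> 0 <= t -> 1 < D -> (upper_box_dim B < t%:E)%E ->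
  exists (c : nat -> seq Y) (par : nat -> Y -> Y) (root : Y) (m : nat) (C : R),
    [/\ c 0 = [:: root], forall k, uniq (c k),
      forall k q, q \in c k.+1 -> par k q \in c k &
      [/\ forall k, {in c k, forall q, B q},
      forall k, (size (c k))%:R <= (D `^ t) ^+ (m + k),
      0 <= C,
      forall k, {in c k.+1, forall q, mdist (par k q) q <= C / D ^+ k} &
      forall k b, B b -> exists2 q, q \in c k.+1 &
        mdist q b <= (D ^+ k.+1)^-1]].
Proof.
move=> B0 t0 D1 dimB; have [e e0 cov] := upper_box_dim_cover B0 dimB.
have D0 : 0 < D by rewrite (lt_trans ltr01).
(* The shift [m] brings all scales below the threshold [e]. *)
have [m me] : exists m, (D ^+ m)^-1 < e.
  have : (D^-1 ^+ k) @[k --> \oo] --> 0 by apply: cvg_expr;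
    rewrite ger0_norm ?invr_ge0 ?(ltW D0)// invf_lt1.
  move=> /(_ _ (nbhsx_ballx 0 e e0))[m _ /(_ m (leqnn m))].
  by rewrite /ball/= sub0r normrN exprVn ger0_norm ?invr_ge0 ?exprn_ge0 ?(ltW
    D0)//; exists m.
have /choice[net netP] : forall k, exists c : seq Y,
    ball_cover B (D ^+ (m + k))^-1 c /\ (size c)%:R <= (D `^ t) ^+ (m + k).
  move=> k; have [||c cc sc] := cov (D ^+ (m + k))^-1.
  - by rewrite invr_gt0 exprn_gt0.
  - apply: le_lt_trans me; rewrite lef_pV2 ?posrE ?exprn_gt0//.
    by rewrite ler_weXn2l ?leq_addr// ltW.
  - exists c; split=> //; move: sc; rewrite invrK.
    by rewrite -!powR_mulrn ?powR_ge0 ?(ltW D0)// -!powRrM mulrC.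
have [root Broot] := B0.
pose c k := if k is k'.+1 then undup (net k) else [:: root].
have cB k : {in c k, forall q, B q}.
  case: k => [|k] q /=; first by rewrite inE => /eqP ->.
  by rewrite mem_undup; have [[+ _] _] := netP k.+1; apply.
have netB k b : B b -> exists2 q, q \in c k.+1 &
    mdist q b <= (D ^+ (m + k.+1))^-1.
  move=> Bb; have [[_ /(_ b Bb)[q qn qb]] _] := netP k.+1.
  by exists q; rewrite //= mem_undup.
have /choice[par parP] : forall k, exists par : Y -> Y, {in c k.+1, forall q,
    par q \in c k /\ ((0 < k)%N -> mdist (par q) q <= (D ^+ (m + k))^-1)}.
  case=> [|k].
    by exists (fun=> root) => q _; split=> //=; rewrite inE.
  have /choice[par parP] : forall q, exists q', q \in c k.+2 ->
      q' \in c k.+1 /\ mdist q' q <= (D ^+ (m + k.+1))^-1.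
    move=> q; have [qc|_] := boolP (q \in c k.+2); last by exists root.
    by have [q' ? ?] := netB k q (cB _ _ qc); exists q'.
  by exists par => q qc; have [] := parP q qc.
(* The sum accounts for the first level, which may be far from the root; at later levels the summand
   1 suffices. *)
pose C := 1 + \sum_(q <- c 1) mdist (par 0 q) q.
have S0 : 0 <= \sum_(q <- c 1) mdist (par 0 q) q.
  by apply: sumr_ge0 => q _; exact: mdist_ge0.
exists c, par, root, m, C; split=> //.
- by case=> //= k; exact: undup_uniq.
- by move=> k q /parP[].
split=> //.
- move=> [|k] /=; last by apply: le_trans (proj2 (netP k.+1));
  rewrite ler_nat size_undup.
  rewrite exprn_ege1//; rewrite -[leLHS](powRr0 D); apply: ler_powR => //.
  exact: ltW.
- by rewrite addr_ge0.
- move=> [|k] q qc.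
    rewrite expr0 divr1 /C (big_rem q)//= addrCA lerDl addr_ge0//.
    by apply: sumr_ge0 => ? _; exact: mdist_ge0.
  have [_ /(_ isT) le] := parP k.+1 q qc; apply: le_trans le _.
  apply: le_trans (_ : (D ^+ k.+1)^-1 <= _).
    by rewrite lef_pV2 ?posrE ?exprn_gt0// ler_weXn2l ?leq_addl// ltW.
  by rewrite ler_peMl ?invr_ge0 ?exprn_ge0 ?(ltW D0)// lerDl.
- move=> k b /(netB k)[q qc qb]; exists q => //; apply: le_trans qb _.
  by rewrite lef_pV2 ?posrE ?exprn_gt0// ler_weXn2l ?leq_addl// ltW.
Qed.

(** * Covering by a Lipschitz image *)

Lemma sum_expr_le (R : realFieldType) (x : R) (n : nat) : 0 <= x -> x < 1 ->
  \sum_(i < n) x ^+ i <= (1 - x)^-1.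
Proof.
move=> x0 x1; have d0 : 0 < 1 - x by rewrite subr_gt0.
rewrite -[leRHS]mul1r ler_pdivlMr// mulrC.
have -> : (1 - x) * \sum_(i < n) x ^+ i = 1 - x ^+ n.
  elim: n => [|n ih]; first by rewrite big_ord0 mulr0 subrr.
  by rewrite big_ord_recr/= mulrDr ih exprS; ring.
by rewrite lerBlDr lerDl exprn_ge0.
Qed.

(** This serves to choose the initial scale: the demand of the whole tree is at most [M * r ^ sigma]
    at any depth. *)
Lemma lt_root_choice (R : realType) (sigma M e delta : R) :
  0 < sigma -> 0 < M -> 0 < e -> 0 < delta ->
  exists2 r, 0 < r <= delta & M * r `^ sigma <= e.
Proof.
move=> sigma0 M0 e0 delta0; exists (Num.min delta ((e / M) `^ sigma^-1)).
  by apply/andP; split; rewrite ?lt_min ?ge_min ?lexx// delta0 powR_gt0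
    ?divr_gt0.
rewrite -ler_pdivlMl// [leRHS]mulrC.
have eM : 0 < e / M by rewrite divr_gt0.
apply: (@le_trans _ _ (((e / M) `^ sigma^-1) `^ sigma)).
  apply: ge0_ler_powR; rewrite ?nnegrE ?powR_ge0 ?(ltW sigma0)//.
    by rewrite le_min powR_ge0 ltW.
  by rewrite ge_min lexx orbT.
by rewrite -powRrM mulVf ?gt_eqF// powRr1 ?(ltW eM).
Qed.

(** The demand is a geometric sum: level [k] has at most [th ^ (m + k)] nodes, [cap k] is
    proportional to [be ^ -k], and [th < be] because [t < sigma]. The bound is uniform in the depth,
    so [C'] is fixed before [n]. *)
Lemma lipschitz_onto_nets (R : realType) (X Y : metricType R)
    (seg : Y -> Y -> R -> Y)
    (A : set X) (B : set Y) (c : nat -> seq Y) (par : nat -> Y -> Y) (root : Y)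
    (m p : nat) (C s t : R) :
  (forall u v, seg u v 0 = u) -> (forall u v, seg u v 1 = v) ->
  (forall u v a b, mdist (seg u v a) (seg u v b) <= `|a - b| * mdist u v) ->
  compact A -> 0 < s -> (s%:E < hausdorff_dim A)%E ->
  (0 < p)%N -> 0 <= t -> t < s * (1 - p%:R^-1) ->
  let D := 2 * p.+1%:R in
  c 0 = [:: root] -> (forall k, uniq (c k)) ->
  (forall k q, q \in c k.+1 -> par k q \in c k) ->
  (forall k, {in c k, forall q, B q}) ->
  (forall k, (size (c k))%:R <= (D `^ t) ^+ (m + k)) ->
  0 <= C ->
  (forall k, {in c k.+1, forall q, mdist (par k q) q <= C / D ^+ k}) ->
  exists2 C', 0 <= C' & forall n, c n != [::] -> exists f : X -> Y,
    [/\ forall x y, mdist (f x) (f y) <= C' * mdist x y,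
      forall x, exists u v a, [/\ B u, B v, 0 <= a <= 1 & f x = seg u v a] &
      {in c n, forall q, exists2 x, A x & f x = q}].
Proof.
move=> seg0 seg1 seg_lip cA s0 sdim p0 t0 ts D c0 c_uniq c_par cB c_size C0
  c_dist.
have [a [delta [a0 delta0 frostman]]] := frostman_compact cA s0 sdim.
set eta : R := p%:R^-1 in ts *.
have eta0 : 0 <= eta by rewrite invr_ge0.
have eta1 : 0 <= 1 - eta by rewrite subr_ge0 invf_le1 ?ler1n ?ltr0n.
set sigma := s * (1 - eta) in ts *.
have sigma0 : 0 < sigma by exact: le_lt_trans ts.
have D4 : 4 <= D by rewrite /D -natrM ler_nat -[4%N]/(2 * 2)%N leq_pmul2l.
have D1 : 1 < D by lra.
have D0 : 0 < D by lra.
set th := D `^ t in c_size *; pose be := D `^ sigma.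
have th1 : 1 <= th by rewrite -[leLHS](powRr0 D); apply: ler_powR => //;
  exact: ltW.
have th0 : 0 < th by lra.
have be0 : 0 < be by exact: powR_gt0.
have thbe : th < be by rewrite /th /be /powR gt_eqF// ltr_expR ltr_pM2r ?ln_gt0.
pose x := th / be.
have x0 : 0 <= x by rewrite divr_ge0// ltW.
have x1 : x < 1 by rewrite ltr_pdivrMr// mul1r.
(* The fraction bounds the geometric series; the summand 1 pays for the extra [cap n] of the last
   level. *)
pose M := th ^+ m * (th / (1 - x) + 1).
have M0 : 0 < M.
  by rewrite mulr_gt0 ?exprn_gt0// ltr_wpDl// divr_ge0 ?(ltW th0)// subr_ge0
    ltW.
have [r0 /andP[r0_gt0 r0_le] r0M] :=
  lt_root_choice sigma0 M0 (powR_gt0 (1 - eta) a0) delta0.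
(* Since [D = 2 (p + 1)], [(p + 1) r k.+1 = rho k]: the balls that [cap k] has to bound are those
   whose mass is at most [rho k ^ s]. *)
pose r k := 2 * r0 / D ^+ k; pose rho k := r0 / D ^+ k.
(* Thus [cap k = rho k ^ sigma]; [4 tau k] is the separation [r k.+1] of leaves whose ancestors
   differ at level [k.+1]. *)
pose cap k := r0 `^ sigma / be ^+ k; pose tau k := r k.+1 / 4.
have r_gt0 k : 0 < r k by rewrite !mulr_gt0 ?invr_gt0 ?exprn_gt0.
have rho_gt0 k : 0 < rho k by rewrite divr_gt0 ?exprn_gt0.
have rS k : r k = D * r k.+1 by rewrite /r exprS; field;
  rewrite expf_neq0 gt_eqF.
have cap_gt0 k : 0 < cap k by rewrite divr_gt0 ?powR_gt0 ?exprn_gt0.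
have tau_gt0 k : 0 < tau k by rewrite divr_gt0.
have tauB k : r0 / D ^+ k.+1 / 4 <= tau k - tau k.+1.
  have := rS k.+1; have := r_gt0 k.+2; rewrite /tau (_ : r0 / _ = r k.+1 / 2).
    nra.
  by rewrite /r; field; rewrite expf_neq0// gt_eqF.
have tau_lt k : tau k.+1 < tau k.
  by rewrite -subr_gt0 (lt_le_trans _ (tauB k))// !divr_gt0 ?exprn_gt0.
have rho_pow k : (rho k `^ s) `^ (1 - eta) = cap k.
  rewrite -powRrM -/sigma /rho /cap powRM ?invr_ge0 ?exprn_ge0 ?(ltW r0_gt0)
    ?(ltW D0)//.
  congr (_ * _); rewrite /be -!powR_mulrn ?powR_ge0 ?(ltW D0)// -!powRN.
  by rewrite -!powRrM; congr (_ `^ _); ring.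
(* By [tauB], an edge of length [C / D ^ k] is run through in time [tau k - tau k.+1] at speed at
   most [C1]. *)
pose C1 := 4 * C * D / r0.
have C10 : 0 <= C1 by rewrite !mulr_ge0 ?invr_ge0 ?(ltW D0) ?(ltW r0_gt0).
have C1tau k : C / D ^+ k <= C1 * (tau k - tau k.+1).
  have -> : C / D ^+ k = C1 * (r0 / D ^+ k.+1 / 4).
    by rewrite /C1 exprS; field; rewrite expf_neq0 !gt_eqF.
  exact: ler_wpM2l.
exists (3 * C1); first by rewrite mulr_ge0.
move=> n cn0.
have [k kn|T [h [mu [hA mu0 mu_rho mass_a]]]] := frostman rho n rho_gt0.
  rewrite /rho; apply/andP; split.
    by rewrite ler_pM2l// lef_pV2 ?posrE ?exprn_gt0// ler_weXn2l// ltW.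
  apply: le_trans r0_le; rewrite ler_pdivrMr ?exprn_gt0// ler_peMr ?(ltW
    r0_gt0)//.
  by rewrite exprn_ege1// ltW.
set d := (fun y z : T => _) in mu_rho.
have dxx y : d y y = 0 by exact: mdistxx.
have dsym y z : d y z = d z y by exact: metric_sym.
have dtri y w z : d w z <= d w y + d y z by exact: metric_triangle.
(* Carving divides by masses, so points of mass 0 are dropped. *)
pose E := [set y | 0 < mu y]%SET.
have massE : mass mu E = mass mu [set: T].
  rewrite /mass [RHS](bigID (mem E))/= [X in _ + X]big1 ?addr0.
    by apply: eq_bigl => y; rewrite !inE.
  move=> y /andP[_]; rewrite inE -leNgt => le; apply/eqP.
  by rewrite eq_le le mu0.
have massE0 : 0 < mass mu E by rewrite massE (lt_le_trans a0).
have [x0T x0E] : exists y, y \in E.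
  have /set0Pn[y yE] : E != finset.set0; last by exists y.
  by apply: contraTneq massE0 => ->; rewrite /mass big_set0 ltxx.
have cap_le k : (k < n)%N -> {in E, forall y,
    mass mu (E :&: fball d y (p.+1%:R * r k.+1)) `^ (1 - eta) <= cap k}.
  move=> kn y _; rewrite -rho_pow ge0_ler_powR ?nnegrE ?mass_ge0 ?powR_ge0//.
  have -> : p.+1%:R * r k.+1 = rho k.
    have : r k = 2 * rho k by rewrite /r /rho mulrA.
    by rewrite rS /D; lra.
  apply: le_trans (mu_rho y k (ltnW kn)).
  by apply: le_mass => //; exact: finset.subsetIr.
have dem : demand c par cap n 0 root <= weight d mu eta E (r 0) E.
  (* No ball in [E] has more mass than [E], so the initial weight is at least
     [mass mu E ^ (1 - eta)]. *)
  apply: (@le_trans _ _ (a `^ (1 - eta))); last first.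
    apply: (@le_trans _ _ (mass mu E `^ (1 - eta))).
      rewrite ge0_ler_powR ?nnegrE ?mass_ge0 ?(ltW a0)//.
      by rewrite massE.
    rewrite powRB; last by rewrite (gt_eqF massE0) implybT.
    rewrite powRr1 ?mass_ge0// {1}/mass mulr_suml; apply: ler_sum => y yE.
    have muy : 0 < mu y by move: yE; rewrite inE.
    rewrite ler_wpM2l// lef_pV2 ?posrE ?powR_gt0//; last first.
      by apply: (@mass_gt0 _ _ mu _ _ y) => //; rewrite inE yE inE dxx ltW.
    rewrite ge0_ler_powR ?nnegrE ?mass_ge0//.
    by apply: le_mass => //; exact: finset.subsetIl.
  have -> : demand c par cap n 0 root = \sum_(q <- c 0) demand c par cap n 0 q.
    by rewrite c0 big_seq1.
  rewrite sum_demand//.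
  apply: le_trans r0M; rewrite /M.
  have capE k i : (size (c (k + i)))%:R * cap i <=
      th ^+ m * th ^+ k * r0 `^ sigma * x ^+ i.
    have -> : th ^+ m * th ^+ k * r0 `^ sigma * x ^+ i =
        th ^+ (m + (k + i)) * cap i.
      by rewrite /cap /x expr_div_n !exprD; field; rewrite expf_neq0// gt_eqF.
    by apply: ler_wpM2r (c_size _); exact: ltW.
  have -> : th ^+ m * (th / (1 - x) + 1) * r0 `^ sigma =
     th ^+ m * th ^+ 1 * r0 `^ sigma * (1 - x)^-1 +
     th ^+ m * th ^+ 0 * r0 `^ sigma * 1.
    by rewrite expr1 expr0; field; rewrite gt_eqF// subr_gt0.
  apply: lerD.
    apply: le_trans (ler_wpM2l _ (sum_expr_le n x0 x1)); last first.
      by rewrite !mulr_ge0 ?exprn_ge0 ?powR_ge0 ?(ltW th0).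
    rewrite mulr_sumr; apply: ler_sum => i _; exact: (capE 1 i).
  apply: le_trans (capE 0 n) _; rewrite ler_wpM2l ?exprn_ile1 ?(ltW x1)//.
  by rewrite !mulr_ge0 ?exprn_ge0 ?powR_ge0 ?(ltW th0).
have [|g gP] := tree_embedding dxx dsym dtri mu0 c0 c_uniq c_par p0 r_gt0 rS
  cap_gt0
   _ cap_le x0T dem.
  by move=> y; rewrite inE.
have [||||f [f_lip f_mem f_val]] := @tree_extension R Y seg seg0 seg1 seg_lip
   tau C1 C10 tau_gt0 tau_lt X Y (c n)
   (fun u k => ancestor par n k u) (h \o g) n B cn0.
- by move=> u un k kn; apply: cB (ancestor_mem c_par un kn).
- move=> u un k kn; rewrite (ancestor_par _ _ kn).
  apply: le_trans (C1tau k); apply: c_dist; exact: (ancestor_mem c_par un kn).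
- move=> u v un vn; have := ancestor_mem c_par un (leq0n n).
  by have := ancestor_mem c_par vn (leq0n n); rewrite c0 !inE => /eqP -> /eqP
    ->.
- move=> u v un vn k kn uv; rewrite /tau mulrC divfK//.
  exact: gP un vn _ kn uv.
exists f; split=> // q qn; exists (h (g q)) => //.
by rewrite (f_val _ qn) ancestor_id.
Qed.

Lemma ereal_two_between (R : realType) (x y : \bar R) :
  (0 <= x)%E -> (x < y)%E ->
  exists t s : R, [/\ 0 <= t, t < s, (x < t%:E)%E & (s%:E < y)%E].
Proof.
case: x => [x||] //; last by case: y.
rewrite lee_fin => x0; case: y => [y||] //.
  rewrite lte_fin => xy; exists (x + (y - x) / 3), (x + 2 * ((y - x) / 3)).
  by split; rewrite ?lte_fin; lra.
by move=> _; exists (x + 1), (x + 2); split; rewrite ?lte_fin ?ltry//; lra.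
Qed.

Lemma lipschitz_cover (R : realType) (X Y : metricType R)
    (seg : Y -> Y -> R -> Y) (A : set X) (B : set Y) :
  (forall u v, seg u v 0 = u) -> (forall u v, seg u v 1 = v) ->
  (forall u v a b, mdist (seg u v a) (seg u v b) <= `|a - b| * mdist u v) ->
  (forall u v u' v' a, 0 <= a <= 1 ->
     mdist (seg u v a) (seg u' v' a) <= mdist u u' + mdist v v') ->
  compact A -> compact B -> B !=set0 ->
  (upper_box_dim B < hausdorff_dim A)%E ->
  exists f : X -> Y, lipschitz_in A f /\ B `<=` f @` A.
Proof.
move=> seg0 seg1 seg_lip seg_dist cA cB B0 dimAB.
have [t [s [t0 ts dimB dimA]]] := ereal_two_between (upper_box_dim_ge0 B0)
  dimAB.
have s0 : 0 < s by lra.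
(* The inequality amounts to [p > s / (s - t)]. *)
have [p p0 tp] : exists2 p, (0 < p)%N & t < s * (1 - p%:R^-1).
  have st0 : 0 <= s / (s - t) by apply: divr_ge0; rewrite ?subr_ge0 ltW.
  have := archi_boundP st0; set p := Num.bound _ => sp.
  have p0 : 0 < p%:R :> R by exact: le_lt_trans sp.
  exists p; first by rewrite -(ltr0n R).
  move: sp; rewrite ltr_pdivrMr ?subr_gt0// => sp.
  rewrite mulrBr mulr1 ltrBrDr -ltrBrDl ltr_pdivrMr//.
  by rewrite mulrC.
pose D : R := 2 * p.+1%:R.
have D1 : 1 < D by rewrite /D -natrM ltr1n mulnS.
have D0 : 0 < D by lra.
have [c [par [root [m [C [c0 c_uniq c_par [c_B c_size C0 c_dist c_net]]]]]]] :=
  box_nets B0 t0 D1 dimB.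
have [C' C'0 stages] := lipschitz_onto_nets seg0 seg1 seg_lip cA s0 dimA p0 t0
  tp c0 c_uniq c_par
  c_B c_size C0 c_dist.
have [b0 Bb0] := B0.
(* Stage [n] uses level [n.+1], as level 0 is only the root; the mesh [(D ^ n.+1)^-1] is the
   covering error. *)
have /choice[f fP] : forall n, exists f : X -> Y,
    [/\ forall x y, mdist (f x) (f y) <= C' * mdist x y,
      forall x, exists u v a, [/\ B u, B v, 0 <= a <= 1 & f x = seg u v a] &
      {in c n.+1, forall q, exists2 x, A x & f x = q}].
  move=> n; apply: stages; have [q + _] := c_net n _ Bb0.
  by apply: contraTneq => ->.
apply: (@compact_lipschitz_limit R X Y seg A B C' f (fun n => (D ^+ n.+1)^-1))
  => //.
- by move=> n; have [] := fP n.
- by move=> n; have [] := fP n.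
- move=> n b /(c_net n)[q qc qb]; have [_ _ fn] := fP n.
  by have [x Ax fx] := fn q qc; exists x => //; rewrite fx.
- have D_cvg : D^-1 ^+ n @[n --> \oo] --> (0 : R).
    by apply: cvg_expr; rewrite ger0_norm ?invr_ge0 ?(ltW D0)// invf_lt1.
  rewrite (_ : (fun n => _) = [sequence (fun n => D^-1 ^+ n) n.+1]_n).
    by rewrite cvg_shiftS.
  by apply/funext => n /=; rewrite exprVn.
Qed.

(** For the second bound, the difference of the two points is [(1 - a) (u - u') + a (v - v')]. Both
    [dist] and [N] are parameters, so that the Hilbert norm and the Euclidean distance on row
    vectors are instances. *)
Lemma linear_segment_bounds (R : realType) (V : lmodType R) (dist : V -> V -> R)
    (N : V -> R) :
  (forall x y, dist x y = N (x - y)) ->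
  (forall a x, N (a *: x) = `|a| * N x) ->
  (forall x y z, dist x z <= dist x y + dist y z) ->
  let seg u v a := u + a *: (v - u) in
  (forall u v a b, dist (seg u v a) (seg u v b) <= `|a - b| * dist u v) /\
  (forall u v u' v' a, 0 <= a <= 1 ->
     dist (seg u v a) (seg u' v' a) <= dist u u' + dist v v').
Proof.
move=> distE NZ tri seg; split=> [u v a b|u v u' v' a /andP[a0 a1]].
  rewrite !distE /seg opprD addrACA subrr add0r -scalerBl NZ.
  by rewrite -(opprB u) -(scaleN1r (u - v)) NZ normrN1 mul1r.
have N0 x : 0 <= N x.
  have := tri x 0 x; rewrite !distE subrr subr0 sub0r.
  by rewrite -(scaleN1r x) NZ normrN1 mul1r -(scale0r (0 : V)) NZ normr0 mul0r;
    lra.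
apply: le_trans (tri _ (seg u' v a) _) _; rewrite !distE; apply: lerD.
  have -> : seg u v a - seg u' v a = (1 - a) *: (u - u').
    rewrite /seg opprD addrACA -scalerBr [v - u - _]addrC opprB addrA subrK.
    by rewrite -[u' - u]opprB scalerN scalerBl scale1r.
  by rewrite NZ ger0_norm ?subr_ge0// ler_piMl// gerBl.
have -> : seg u' v a - seg u' v' a = a *: (v - v').
  by rewrite /seg opprD addrACA subrr add0r -scalerBr opprB addrA subrK.
by rewrite NZ ger0_norm// ler_piMl.
Qed.

Lemma empty_cover (R : realType) (X Y : metricType R) (A : set X) (y : Y) :
  exists f : X -> Y, lipschitz_in A f /\ set0 `<=` f @` A.
Proof.
exists (fun=> y); split=> //.
by exists 0 => x z _ _; rewrite mdistxx mul0r.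
Qed.

Lemma euclidean_distZ (R : realType) (n : nat) (a : R) (x : 'rV[R]_n) :
  euclidean_dist (a *: x) 0 = `|a| * euclidean_dist x 0.
Proof.
rewrite /euclidean_dist -sqrtr_sqr -sqrtrM ?sqr_ge0// mulr_sumr.
by congr Num.sqrt; apply: eq_bigr => i _; rewrite !mxE; ring.
Qed.

Lemma euclidean_distB (R : realType) (n : nat) (x y : 'rV[R]_n) :
  euclidean_dist x y = euclidean_dist (x - y) 0.
Proof.
by congr Num.sqrt; apply: eq_bigr => i _; rewrite !mxE subr0.
Qed.

Theorem corollary1p8 (R : realType) :
  (forall (X Y : hilbertType R) (A : set X) (B : set Y),
    compact A -> compact B -> (upper_box_dim B < hausdorff_dim A)%E ->
    exists f : X -> Y, lipschitz_in A f /\ B `<=` f @` A) /\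
  (forall (X : metricType R) (n : nat) (A : set X) (B : set (euclidean R n)),
    compact A -> compact B -> (upper_box_dim B < hausdorff_dim A)%E ->
    exists f : X -> euclidean R n, lipschitz_in A f /\ B `<=` f @` A).
Proof.
split=> [X Y A B cA cB dimAB|X n A B cA cB dimAB].
  have [->|/set0P B0] := eqVneq B set0; first exact: (empty_cover A (0 : Y)).
  have [|lip dist] := @linear_segment_bounds R Y (fun x y => mdist x y)
    (fun x => `|x|) (@hilbert_mdistE R Y) (@normrZ R Y).
    by move=> x y z; exact: metric_triangle.
  apply: (lipschitz_cover _ _ lip dist cA cB B0 dimAB) => u v.
    by rewrite scale0r addr0.
  by rewrite scale1r addrC subrK.
have [->|/set0P B0] := eqVneq B set0.
  exact: (@empty_cover R X (euclidean R n) A (0 : 'rV[R]_n)).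
have [|lip dist] := @linear_segment_bounds R 'rV[R]_n (@euclidean_dist R n)
  (fun x => euclidean_dist x 0) (@euclidean_distB R n) (@euclidean_distZ R n).
  by move=> x y z; exact: euclidean_dist_triangle.
apply: (@lipschitz_cover R X (euclidean R n) _ A B _ _ lip dist) => // u v.
  by rewrite scale0r addr0.
by rewrite scale1r addrC subrK.
Qed.
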